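(* An ABC voting rule $f$ (for fixed $m\ge 2$ and fixed committee size $k\in\{1,\dots,m-1\}$) is a BSWAV rule if and only if it satisfies anonymity, neutrality, consistency, continuity, choice set convexity, and weak efficiency.
   Context: Let $\mathcal C=\{c_1,\dots,c_m\}$ be a set of $m\ge 2$ candidates and $\mathbb N=\{1,2,\dots\}$ the set of potential voters. An electorate is a non-empty finite $N\subseteq\mathbb N$. An approval ballot is a non-empty subset of $\mathcal C$; $\mathcal A$ is the set of all ballots. A profile is a map $A:N\to\mathcal A$ for some electorate $N=N_A$, with $A_i$ the ballot of voter $i$; $\mathcal A^*$ is the set of all profiles. Profiles $A,A'$ are disjoint if $N_A\cap N_{A'}=\emptyset$, and then $A+A'$ is the profile on $N_A\cup N_{A'}$ agreeing with $A$ on $N_A$ and with $A'$ on $N_{A'}$. For $\lambda\in\mathbb N$, $\lambda A$ denotes a profile consisting of $\lambda$ copies of $A$ on pairwise disjoint voter sets. Fix $k\in\{1,\dots,m-1\}$; $\mathcal W_k=\{W\subseteq\mathcal C:|W|=k\}$ is the set of committees. An ABC voting rule is a map $f:\mathcal A^*\to 2^{\mathcal W_k}\setminus\{\emptyset\}$. Axioms: $f$ is anonymous if $f(A)=f(\pi(A))$ for all $A$ and permutations $\pi$ of $\mathbb N$, where $\pi(A)$ has electorate $\pi(N_A)$ and $\pi(A)_{\pi(i)}=A_i$. $f$ is neutral if $f(\tau(A))=\{\tau(W):W\in f(A)\}$ for all $A$ and permutations $\tau$ of $\mathcal C$, where $\tau(A)_i=\tau(A_i)$. $f$ is consistent if $f(A+A')=f(A)\cap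 f(A')$ for all disjoint $A,A'$ with $f(A)\cap f(A')\neq\emptyset$. $f$ is continuous if for all profiles $A,A'$ there is $\lambda\in\mathbb N$ with $f(\lambda A+A')\subseteq f(A)$. $f$ is weakly efficient if whenever $W\in f(A)$ and $c\in W\setminus\bigcup_{i\in N_A}A_i$, then $(W\cup\{c'\})\setminus\{c\}\in f(A)$ for every $c'\in\mathcal C\setminus W$. $f$ is choice set convex if $W,W'\in f(A)$ implies $W''\in f(A)$ for every $W''\in\mathcal W_k$ with $W\cap W'\subseteq W''\subseteq W\cup W'$. A BSWAV (ballot size weighted approval voting) rule is defined by a weight vector $\alpha=(\alpha_1,\dots,\alpha_m)\in\mathbb R^m_{\ge0}$ and chooses, for every profile $A$, the committees $W\in\mathcal W_k$ maximizing $\hat s(A,W)=\sum_{i\in N_A}\alpha_{|A_i|}\,|A_i\cap W|$. *)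

(* Defs.v *)
From HB Require Import structures.
From mathcomp Require Import all_boot all_order all_algebra all_fingroup finmap.
From mathcomp Require Import reals.
Set Implicit Arguments. Unset Strict Implicit. Unset Printing Implicit Defensive.
Import Order.TTheory GRing.Theory Num.Theory.
Local Open Scope fset_scope.
Local Open Scope fmap_scope.

(* Candidates: 'I_m.  Potential voters: nat.  A raw profile is a finite
   partial map from voters to candidate sets; a profile is a raw profile with
   non-empty electorate and non-empty ballots. *)
Definition rawprof (m : nat) := {fmap nat -> {set 'I_m}}.

Definition valid_prof m (A : rawprof m) : bool :=
  (domf A != fset0) && [forall i : domf A, A i != set0].

Definition profile (m : nat) := {A : rawprof m | valid_prof A}.

Definition electorate m (A : profile m) : {fset nat} := domf (val A).

Definition look m (A : profile m) (i : nat) : option {set 'I_m} := (val A).[? i].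

Definition is_ABC_rule m k (f : profile m -> {set {set 'I_m}}) : Prop :=
  forall A, f A != set0 /\ (forall W, W \in f A -> #|W| = k).

Definition disjoint_prof m (A A' : profile m) : Prop :=
  electorate A `&` electorate A' = fset0.

Definition is_sum m (A A' B : profile m) : Prop :=
  forall i, look B i = if i \in electorate A then look A i else look A' i.

(* C = lam A : lam copies of A, the t-th copy being A relabelled along the
   voter map (sigma t), on pairwise disjoint voter sets *)
Definition is_copies m (lam : nat) (A C : profile m) : Prop :=
  exists sigma : nat -> nat -> nat,
    [/\ (forall t t' i i', t < lam -> t' < lam ->
           i \in electorate A -> i' \in electorate A ->
           sigma t i = sigma t' i' -> t = t' /\ i = i'),
        (forall j, j \in electorate C <->
           exists t i, [/\ t < lam, i \in electorate A & j = sigma t i]) &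
        (forall t i, t < lam -> i \in electorate A ->
           look C (sigma t i) = look A i)].

Section RuleProps.
Variables (m k : nat) (f : profile m -> {set {set 'I_m}}).

Definition anonymous : Prop :=
  forall (pi pinv : nat -> nat) (A B : profile m),
    cancel pi pinv -> cancel pinv pi ->
    (forall j, look B j = look A (pinv j)) -> f A = f B.

Definition neutral : Prop :=
  forall (tau : {perm 'I_m}) (A B : profile m),
    (forall i, look B i = omap (fun S : {set 'I_m} => tau @: S) (look A i)) ->
    f B = [set (tau @: W) | W : {set 'I_m} in f A].

Definition consistent : Prop :=
  forall A A' B : profile m, disjoint_prof A A' -> is_sum A A' B ->
    f A :&: f A' != set0 -> f B = f A :&: f A'.

Definition continuous : Prop :=
  forall A A' : profile m, exists2 lam : nat, 0 < lam &
    forall C B : profile m, is_copies lam A C -> disjoint_prof C A' ->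
      is_sum C A' B -> f B \subset f A.

Definition weakly_efficient : Prop :=
  forall (A : profile m) (W : {set 'I_m}) (c : 'I_m),
    W \in f A -> c \in W ->
    (forall i S, look A i = Some S -> c \notin S) ->
    forall c', c' \notin W -> (W :|: [set c']) :\ c \in f A.

Definition choice_set_convex : Prop :=
  forall (A : profile m) (W W' W'' : {set 'I_m}),
    W \in f A -> W' \in f A -> #|W''| = k ->
    W :&: W' \subset W'' -> W'' \subset W :|: W' -> W'' \in f A.

(* BSWAV score with weight vector alpha (alpha j is the weight of ballots of
   size j; only j = 1..m matter) *)
Definition bswav_score (R : realType) (alpha : nat -> R) (A : profile m)
    (W : {set 'I_m}) : R :=
  \sum_(i : domf (val A)) (alpha #|val A i| * (#|val A i :&: W|)%:R)%R.

Definition is_BSWAV (R : realType) : Prop :=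
  exists alpha : nat -> R, (forall j, (0 < j <= m)%N -> (0 <= alpha j)%R) /\
    forall A : profile m,
      f A = [set W : {set 'I_m} | (#|W| == k) &&
              [forall W' : {set 'I_m}, (#|W'| == k) ==>
                 (bswav_score alpha A W' <= bswav_score alpha A W)%R]].

End RuleProps.

(* Main.v *)
Require Import Defs.
From HB Require Import structures.
From mathcomp Require Import all_boot all_order all_algebra all_fingroup finmap.
From mathcomp Require Import boolp reals zify lra.

(** Anonymity reduces a rule to ballot counts, and since uniform profiles are
    neutral it extends to a rule [F] on integer vectors indexed by ballots.  The
    vectors [v] on which [F] selects every committee form a subgroup that can be
    ignored.  For [t = (e_{Z+a} - e_{Z+b}) - (e_{Z'+a} - e_{Z'+b})] with
    [Z' = Z - c + d], both transpositions [(a b)] and [(c d)] map [t] to [- t];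
    with choice set convexity this forces [t] into that subgroup.  Hence a vector
    matters only through the number of approvals of each candidate by ballots of
    each size.  Comparing candidates gives a total order on integer size vectors,
    archimedean by continuity, hence represented by real weights; consistency
    then shows that [F] selects the top candidates, and weak efficiency makes
    the weights nonnegative. *)

Set Implicit Arguments. Unset Strict Implicit. Unset Printing Implicit Defensive.
Import Order.TTheory GRing.Theory Num.Theory.
Local Open Scope ring_scope.

(** * Archimedean totally preordered groups *)

(** The vector [t] is a second difference: it records how the choice between [a] and [b] interacts
    with the choice between [c] and [d] inside one ballot. Its four ballots have equal size and the
    approvals of every candidate cancel, so each BSWAV rule ignores [t]; it is convexity that
    excludes rules reacting to it. Everything up to the weights happens in groups of integer
    vectors, so the weights come from Dedekind cuts instead of separating hyperplanes. The price is
    a common multiple of binomials, harmless because [F] is invariant under positive multiples.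
    Consistency says something only when a common winner exists, and the vectors attached to single
    candidates need not share one. Therefore the size vector of the candidate ranked [k]-th is
    subtracted from that of every candidate, which changes the total by a symmetric, hence neutral,
    vector. Ballots naming all candidates distinguish no committees, so [f] does not determine the
    weight of size [m]; it is chosen to be 0. *)

Lemma archimedean_order_embedding (R : realType) (G : zmodType) (P : G -> Prop) :
  P 0 -> (forall x y, P x -> P y -> P (x + y)) ->
  (forall x, P x \/ P (- x)) ->
  (forall x y, ~ P (- y) -> exists n, ~ P (- (y *+ n + x))) ->
  exists phi : G -> R, (forall x y, phi (x + y) = phi x + phi y) /\
    (forall x, P x <-> 0 <= phi x).
Proof.
move=> P0 PD Ptot Parch.
have PMn x n : P x -> P (x *+ n).
  by move=> Px; elim: n => [|n IHn]; rewrite ?mulr0n // mulrS; apply: PD.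
have nPN x : ~ P x -> P (- x) by case: (Ptot x).
have [[u nPu]|allP] := EM (exists u, ~ P (- u)); last first.
  exists (fun=> 0); split=> [x y|x]; first by rewrite addr0.
  split=> // _; apply/not_notP => nPx; apply: allP; exists (- x).
  by rewrite opprK.
have Pu : P u by rewrite -[u]opprK; apply: nPN.
have PMz (z : int) : P (u *~ z) -> 0 <= z.
  case: z => [n|n] //; rewrite NegzE mulrNz => Pz; exfalso; apply: nPu.
  have -> : - u = u *+ n + - (u *~ n.+1) by rewrite -pmulrn mulrS opprD addrCA subrr addr0.
  by apply: PD => //; apply: PMn.
(* [D x] is the lower cut of [x / u]: the fractions [p / q] with [u *~ p] below [x *+ q] in the
   preorder with positive cone [P]. Its supremum becomes [phi x]. *)
pose D x : classical_sets.set R := fun r => exists p : int, exists2 q : nat,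
  (0 < q)%N /\ P (x *+ q - u *~ p) & r = p%:~R / q%:R.
have DD x y r s : D x r -> D y s -> D (x + y) (r + s).
  move=> [p [q [q0 Px] ->]] [p' [q' [q0' Py] ->]].
  exists (p * q'%:Z + p' * q%:Z), (q * q')%N.
    split; first by rewrite muln_gt0 q0.
    have -> : (x + y) *+ (q * q') - u *~ (p * q'%:Z + p' * q%:Z) =
              (x *+ q - u *~ p) *+ q' + (y *+ q' - u *~ p') *+ q.
      rewrite mulrzDr !mulrzA -!pmulrn !mulrnBl mulrnDl !mulrnA opprD addrACA.
      by rewrite [y *+ q *+ q']mulrnAC.
    by apply: PD; apply: PMn.
  by rewrite rmorphD !rmorphM /= addf_div ?pnatr_eq0 -?lt0n.
have DB x y r s : D x r -> D y s -> P (- (x + y)) -> r + s <= 0.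
  move=> Dr Ds Pxy; have [p [q [q0 Pq] ->]] := DD _ _ _ _ Dr Ds.
  have: P (u *~ (- p)).
    have -> : u *~ - p = ((x + y) *+ q - u *~ p) + (- (x + y)) *+ q.
      by rewrite mulNrn addrC addrA addNr add0r mulrNz.
    by apply: PD => //; apply: PMn.
  move/PMz; rewrite oppr_ge0 => p0; rewrite pmulr_lle0 ?invr_gt0 ?ltr0n //.
  by rewrite lerz0.
have Dex x : exists r, D x r.
  have [n /nPN] := Parch x u nPu; rewrite opprK => Pn.
  exists ((- n%:Z)%:~R / 1%:R), (- n%:Z), 1%N => //.
  by rewrite mulrNz opprK mulr1n -pmulrn addrC.
have Dsup x : classical_sets.has_sup (D x).
  split; first exact: Dex.
  have [s Ds] := Dex (- x); exists (- s) => r Dr.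
  by rewrite -subr_le0 opprK; apply: DB Dr Ds _; rewrite subrr oppr0.
have Dle x r : D x r -> r <= sup (D x) by apply: sup_upper_bound.
have phi_super x y : sup (D x) + sup (D y) <= sup (D (x + y)).
  rewrite leNgt; apply/negP => lt_xy.
  pose e := (sup (D x) + sup (D y) - sup (D (x + y))) / 2.
  have e0 : 0 < e by rewrite divr_gt0 ?subr_gt0.
  have [r Dr xr] := sup_adherent e0 (Dsup x).
  have [s Ds ys] := sup_adherent e0 (Dsup y).
  have := Dle _ _ (DD _ _ _ _ Dr Ds); apply/negP; rewrite -ltNge.
  have -> : sup (D (x + y)) = (sup (D x) - e) + (sup (D y) - e).
    by rewrite addrACA -opprD -splitr opprB addrC subrK.
  exact: ltrD.
have phiN x : sup (D (- x)) = - sup (D x).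
  apply/eqP; rewrite eq_le; apply/andP; split.
    apply: ge_sup; first by have [] := Dsup (- x).
    move=> s Ds; rewrite lerNr; apply: ge_sup; first by have [] := Dsup x.
    move=> r Dr; rewrite -subr_le0 opprK; apply: DB Dr Ds _.
    by rewrite subrr oppr0.
  (* A gap would contain a rational [r]; totality puts [r] in [D x] or [- r] in [D (- x)], above the
     supremum in either case. *)
  rewrite leNgt; apply/negP; rewrite ltrNr => /rat_in_itvoo[r].
  rewrite in_itv /= => /andP[xr rx].
  have r_frac : ratr r = (numq r)%:~R / (`|denq r|%N)%:R :> R.
    by rewrite /ratr -[in LHS]absz_denq.
  have [Pr|Pr] := Ptot (x *+ `|denq r|%N - u *~ numq r).
    have /Dle : D x (ratr r)
      by exists (numq r), `|denq r|%N => //; rewrite absz_gt0 denq_neq0.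
    by rewrite leNgt xr.
  have /Dle : D (- x) (- ratr r).
    exists (- numq r), `|denq r|%N; last by rewrite r_frac rmorphN mulNr.
    by split; rewrite ?absz_gt0 ?denq_neq0 // mulNrn mulrNz opprK addrC -opprB.
  by rewrite leNgt ltrNr rx.
exists (fun x => sup (D x)); split=> [x y|x].
  apply/eqP; rewrite eq_le phi_super andbT.
  by have := phi_super (x + y) (- y); rewrite addrK phiN lerBlDr.
split=> [Px|].
  by apply: Dle; exists 0, 1%N; rewrite ?mul0r // mulr0z subr0.
move=> x0; apply/not_notP => nPx.
(* For [x] strictly negative, some multiple of [- x] reaches [u], so a fraction [1 / n] lies in the
   cut of [- x] and [phi x] is negative. *)
have [|n] := Parch (- u) (- x); first by rewrite opprK.
rewrite opprD opprK mulNrn opprK => /nPN.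
case: n => [|n]; rewrite ?mulr0n ?add0r ?opprK // => Pn.
have /Dle : D (- x) (1%:~R / n.+1%:R).
  by exists 1, n.+1 => //; split=> //; rewrite mulr1z mulNrn -opprD.
rewrite phiN; apply/negP; rewrite -ltNge (@le_lt_trans _ _ 0) ?oppr_le0 //.
by rewrite divr_gt0 ?ltr0n.
Qed.

(** * Exchanges of committee members *)

(** Each exchange moves [A] one step towards [B], so [#|A :\: B|] decreases. The target stays fixed,
    hence [E] needs no transitivity: the second premise does the chaining. *)
Lemma exchange_ind (T : finType) (E : {set T} -> {set T} -> Prop) :
  (forall A, E A A) ->
  (forall (A B : {set T}) a b, a \in A -> b \notin A -> a \notin B -> b \in B ->
     E (b |: A :\ a) B -> E A B) ->
  forall A B : {set T}, #|A| = #|B| -> E A B.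
Proof.
move=> E0 E1 A B; have [n] := ubnP #|A :\: B|.
elim: n A => // n IHn A ltAn eqAB.
have [AB0|[a]] := set_0Vmem (A :\: B).
  suff -> : A = B by apply: E0.
  by apply/eqP; rewrite eqEcard -setD_eq0 AB0 eqxx eqAB leqnn.
rewrite inE => /andP[aB aA].
have [BA0|[b]] := set_0Vmem (B :\: A).
  suff eAB : B = A by rewrite eAB aA in aB.
  by apply/eqP; rewrite eqEcard -setD_eq0 BA0 eqxx eqAB leqnn.
rewrite inE => /andP[bA bB].
have ltA : (#|(b |: A :\ a) :\: B| < #|A :\: B|)%N.
  rewrite [X in (_ < X)%N](cardsD1 a) !inE aA aB ltnS; apply: subset_leq_card.
  apply/subsetP=> x; rewrite !inE; have [->|_] := eqVneq x b; first by rewrite bB.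
  by case: (x == a) => //=; rewrite andbF.
apply: (E1 _ _ a b) => //; apply: IHn.
  by rewrite ltnS in ltAn; apply: leq_trans ltA _.
rewrite cardsU1 !inE (negPf bA) andbF add1n -eqAB (cardsD1 a A) aA //.
Qed.

Lemma card_exchange (T : finType) (A : {set T}) a b :
  a \in A -> b \notin A -> #|b |: A :\ a| = #|A|.
Proof.
by move=> aA bA; rewrite cardsU1 !inE (negPf bA) andbF (cardsD1 a A) aA.
Qed.

Lemma imset_tperm_fix (T : finType) (A : {set T}) a b :
  (a \in A) = (b \in A) -> tperm a b @: A = A.
Proof.
move=> eqab; apply/setP=> x; rewrite -[x in LHS](tpermK a b).
rewrite mem_imset; last exact: perm_inj.
by case: tpermP => [->|->|].
Qed.

Lemma imset_tperm_exchange (T : finType) (A : {set T}) a b :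
  a \in A -> b \notin A -> tperm a b @: A = b |: A :\ a.
Proof.
move=> aA bA; apply/setP=> x; rewrite -[x in LHS](tpermK a b).
rewrite mem_imset; last exact: perm_inj.
rewrite !inE; case: tpermP => [->|->|/eqP xa /eqP xb].
- by rewrite (negPf bA) eqxx /= orbF; apply/esym/negbTE/(memPn bA).
- by rewrite eqxx aA.
- by rewrite (negPf xa) (negPf xb).
Qed.

(** Fixing all points on which [A] and [B] agree allows a committee to be moved without moving the
    candidate that a vector singles out. *)
Lemma perm_set_transitive (T : finType) (A B : {set T}) :
  #|A| = #|B| -> exists2 s : {perm T}, s @: A = B &
    forall c, (c \in A) = (c \in B) -> s c = c.
Proof.
move: A B; apply: exchange_ind => [A|A B a b aA bA aB bB [s sA fix_s]].
  by exists 1%g => [|c _]; rewrite ?perm1 // (eq_imset _ (@perm1 T)) imset_id.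
exists (tperm a b * s)%g => [|c cAB].
  by rewrite (eq_imset _ (permM _ _)) imset_comp imset_tperm_exchange.
have ca : c != a by apply/eqP=> ca; move: cAB; rewrite ca aA (negPf aB).
have cb : c != b by apply/eqP=> cb; move: cAB; rewrite cb bB (negPf bA).
rewrite permM tpermD ?[_ == c]eq_sym // fix_s // !inE (negPf ca) (negPf cb).
exact: cAB.
Qed.

Lemma ex_subset_card (T : finType) (B : {set T}) (k : nat) :
  (k <= #|B|)%N -> exists2 W : {set T}, W \subset B & #|W| = k.
Proof.
case/card_geqP=> s [s_uniq s_k sB]; exists [set x in s].
  by apply/subsetP=> x; rewrite inE => /sB.
by rewrite cardsE (card_uniqP s_uniq).
Qed.

(** [W] has the largest total and [a0] is its worst member; an outsider better than [a0] could
    replace it. *)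
Lemma topk_threshold (R : realDomainType) (T : finType) (k : nat) (g : T -> R) :
  (0 < k <= #|T|)%N -> exists a0 : T, exists2 W : {set T}, #|W| = k &
    forall c, if c \in W then g a0 <= g c else g c <= g a0.
Proof.
move=> /andP[k0 kT].
have [|W0 _ /eqP W0k] := @ex_subset_card T [set: T] k; first by rewrite cardsT.
have [W /eqP Wk Wmax] :=
  @arg_maxP _ _ _ W0 (fun W => #|W| == k) (fun W => \sum_(c in W) g c) W0k.
have [x xW] : exists x, x \in W by apply/set0Pn; rewrite -card_gt0 Wk.
have [a0 a0W a0min] := @arg_minP _ _ _ x (mem W) g xW.
exists a0; exists W => // c; case: ifPn => [/a0min//|cW].
have := Wmax (c |: W :\ a0); rewrite card_exchange // Wk eqxx => /(_ isT).
rewrite big_setU1 ?inE ?(negPf cW) ?andbF //= (big_setD1 _ a0W) /=.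
by rewrite lerD2r.
Qed.

(* The committees satisfying the threshold condition are exactly those that
   collect the whole positive part of [g - y]. *)
Lemma threshold_argmax (R : realDomainType) (T : finType) (k : nat) (g : T -> R)
    (y : R) (W0 : {set T}) : #|W0| = k ->
  (forall c, if c \in W0 then y <= g c else g c <= y) ->
  forall U : {set T}, #|U| = k ->
  (forall c, if c \in U then y <= g c else g c <= y) <->
  (forall U' : {set T}, #|U'| = k -> \sum_(c in U') g c <= \sum_(c in U) g c).
Proof.
move=> W0k W0y U Uk; pose h c := g c - y.
have sum_h (V : {set T}) : #|V| = k ->
    \sum_(c in V) g c = \sum_c (if c \in V then h c else 0) + y *+ k.
  move=> Vk; rewrite -big_mkcond /= big_split /= sumr_const Vk mulNrn subrK //.
have le_pos (V : {set T}) c : (if c \in V then h c else 0) <= Num.max (h c) 0.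
  by case: ifP; rewrite le_max lexx ?orbT.
have eq_pos (V : {set T}) : (forall c, if c \in V then y <= g c else g c <= y) ->
    forall c, (if c \in V then h c else 0) = Num.max (h c) 0.
  move=> Vy c; have := Vy c; rewrite /h; case: ifP => _ yc.
    by rewrite max_l // subr_ge0.
  by rewrite max_r // subr_le0.
split=> [Uy U' U'k|Umax c].
  rewrite !sum_h // lerD2r; apply: ler_sum => c _.
  by rewrite (eq_pos U Uy) le_pos.
have : \sum_c (Num.max (h c) 0 - (if c \in U then h c else 0)) <= 0.
  rewrite sumrB subr_le0 -(eq_bigr _ (fun c _ => eq_pos W0 W0y c)).
  by have := Umax W0 W0k; rewrite !sum_h // lerD2r.
have ge0 c' : true -> 0 <= Num.max (h c') 0 - (if c' \in U then h c' else 0).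
  by rewrite subr_ge0.
rewrite le_eqVlt ltNge sumr_ge0 // orbF psumr_eq0 // => /allP/(_ c).
rewrite mem_index_enum => /(_ isT); rewrite /= subr_eq0 /h.
case: ifP => _ /eqP e.
  by rewrite -subr_ge0 -e le_max lexx orbT.
by rewrite -subr_le0 -[X in _ <= X]e le_max lexx.
Qed.

(** * Integer ballot vectors *)

(** Entries are signed so that vectors form a group. The entry at the empty set corresponds to no
    ballot and is kept for uniformity. *)
Definition ballot_vec (m : nat) := {ffun {set 'I_m} -> int}.

Definition unit_vec m (S : {set 'I_m}) : ballot_vec m := [ffun T => (T == S)%:R].

Definition perm_vec m (s : {perm 'I_m}) (v : ballot_vec m) : ballot_vec m :=
  [ffun S : {set _} => v (s @^-1: S)].

Lemma perm_vecB m (s : {perm 'I_m}) v w :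
  perm_vec s (v - w) = perm_vec s v - perm_vec s w.
Proof. by apply/ffunP=> S; rewrite !ffunE. Qed.

Lemma perm_vec0 m (s : {perm 'I_m}) : perm_vec s 0 = 0.
Proof. by apply/ffunP=> S; rewrite !ffunE. Qed.

Lemma perm_vecN m (s : {perm 'I_m}) v : perm_vec s (- v) = - perm_vec s v.
Proof. by rewrite -sub0r perm_vecB perm_vec0 sub0r. Qed.

Lemma perm_vecMn m (s : {perm 'I_m}) v n : perm_vec s (v *+ n) = perm_vec s v *+ n.
Proof. by apply/ffunP=> S; rewrite !ffunE !ffunMnE ffunE. Qed.

Lemma perm_vec_sum m (s : {perm 'I_m}) (I : Type) (r : seq I) (P : pred I)
    (v : I -> ballot_vec m) :
  perm_vec s (\sum_(i <- r | P i) v i) = \sum_(i <- r | P i) perm_vec s (v i).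
Proof.
by apply/ffunP=> S; rewrite ffunE !sum_ffunE; apply: eq_bigr => i _; rewrite ffunE.
Qed.

Lemma preimset_perm_eq (T : finType) (s : {perm T}) (A B : {set T}) :
  (s @^-1: A == B) = (A == s @: B).
Proof.
apply/eqP/eqP=> [<-|->]; apply/setP=> x.
  rewrite -[x in RHS](permKV s) mem_imset ?inE ?permKV //; exact: perm_inj.
by rewrite inE mem_imset //; apply: perm_inj.
Qed.

Lemma card_preimset_perm (T : finType) (s : {perm T}) (A : {set T}) :
  #|s @^-1: A| = #|A|.
Proof. by rewrite card_preimset //; apply: perm_inj. Qed.

Lemma perm_unit_vec m (s : {perm 'I_m}) S : perm_vec s (unit_vec S) = unit_vec (s @: S).
Proof. by apply/ffunP=> T; rewrite !ffunE preimset_perm_eq. Qed.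

Lemma ballot_vec_ind m (Q : ballot_vec m -> Prop) :
  (forall S, Q (unit_vec S)) -> (forall v w, Q v -> Q w -> Q (v - w)) ->
  forall v, Q v.
Proof.
move=> Qe QB v.
have Q0 : Q 0 by rewrite -(subrr (unit_vec set0)); apply: QB.
have QN w : Q w -> Q (- w) by rewrite -sub0r; apply: QB.
have QD w1 w2 : Q w1 -> Q w2 -> Q (w1 + w2).
  by move=> Q1 /QN Q2; rewrite -[w2]opprK; apply: QB.
have QMn w n : Q w -> Q (w *+ n).
  by move=> Qw; elim: n => [|n IHn]; rewrite ?mulr0n // mulrS; apply: QD.
have -> : v = \sum_S unit_vec S *~ v S.
  apply/ffunP=> T; rewrite sum_ffunE (bigD1 T) //= big1 ?addr0 => [|S neST].
    by rewrite ffunMzE ffunE eqxx intz.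
  by rewrite ffunMzE ffunE eq_sym (negPf neST) mul0rz.
elim/big_ind: _ => // S _; case: (v S) => n.
  by rewrite -pmulrn; apply: QMn.
by rewrite NegzE mulrNz -pmulrn; apply/QN/QMn.
Qed.

Definition swap_vec m (a b : 'I_m) (Z : {set 'I_m}) : ballot_vec m :=
  unit_vec (a |: Z) - unit_vec (b |: Z).

Lemma perm_swap_vec m (s : {perm 'I_m}) a b Z :
  perm_vec s (swap_vec a b Z) = swap_vec (s a) (s b) (s @: Z).
Proof. by rewrite perm_vecB !perm_unit_vec !imsetU1. Qed.

Lemma swap_vecN m (a b : 'I_m) Z : swap_vec b a Z = - swap_vec a b Z.
Proof. by rewrite opprB. Qed.

Definition star_vec m (l : nat) (c : 'I_m) : ballot_vec m :=
  [ffun S : {set 'I_m} => ((c \in S) && (#|S| == l))%:R].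

Lemma perm_star_vec m (s : {perm 'I_m}) l c :
  perm_vec s (star_vec l c) = star_vec l (s c).
Proof. by apply/ffunP=> S; rewrite !ffunE inE card_preimset_perm. Qed.

(** Ballots containing both [a] and [b] cancel; the others pair up as [a |: Z] and [b |: Z]. *)
Lemma star_vecB m l (a b : 'I_m) : (0 < l)%N -> a != b ->
  star_vec l a - star_vec l b =
  \sum_(Z in [set Z : {set 'I_m} | Z \subset ~: [set a; b] & #|Z| == l.-1])
     swap_vec a b Z.
Proof.
move=> l0 neab.
have sumE (x y : 'I_m) (S : {set 'I_m}) : x != y ->
    \sum_(Z in [set Z : {set 'I_m} | Z \subset ~: [set x; y] & #|Z| == l.-1])
      (S == x |: Z)%:R = [&& x \in S, y \notin S & #|S| == l]%:R :> int.
  move=> nexy; have subE (Z : {set 'I_m}) :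
      (Z \subset ~: [set x; y]) = (x \notin Z) && (y \notin Z).
    rewrite subsetC subUset !sub1set !inE //.
  have [/and3P[xS yS /eqP Sl]|nS] := boolP [&& x \in S, y \notin S & #|S| == l].
    rewrite (bigD1 (S :\ x)) /=; last first.
      rewrite inE subE !inE eqxx (negPf yS) andbF /= -Sl (cardsD1 x S) xS //.
    rewrite setD1K // eqxx big1 ?addr0 // => Z /andP[].
    rewrite inE subE -andbA => /and3P[xZ _ _] neZ.
    by case: (S =P x |: Z) neZ => // ->; rewrite setU1K ?eqxx.
  rewrite big1 // => Z; rewrite inE subE => /andP[/andP[xZ yZ] /eqP Zl].
  case: (S =P x |: Z) nS => // ->; rewrite !inE eqxx eq_sym (negPf nexy) (negPf yZ) /=.
  by rewrite cardsU1 xZ Zl add1n prednK ?eqxx.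
apply/ffunP=> S; rewrite !ffunE sum_ffunE.
under eq_bigr do rewrite !ffunE.
rewrite sumrB sumE // [[set a; b]]setUC sumE; last by rewrite eq_sym.
by case: (a \in S); case: (b \in S); case: (_ == l).
Qed.

Definition candidate_score (R : realType) m (alpha : nat -> R) (v : ballot_vec m)
    (c : 'I_m) : R :=
  \sum_(S : {set 'I_m} | c \in S) alpha #|S| * (v S)%:~R.

(** * Rules on ballot vectors *)

Section VectorRule.

Variables (m k : nat) (F : ballot_vec m -> {set {set 'I_m}}).
Hypothesis k_bounds : (0 < k < m)%N.
Hypothesis F_neq0 : forall v, F v != set0.
Hypothesis F_card : forall v W, W \in F v -> #|W| = k.
Hypothesis F_neutral : forall (s : {perm 'I_m}) v (W : {set 'I_m}),
  W \in F v -> s @: W \in F (perm_vec s v).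
Hypothesis F_consistent : forall v w,
  F v :&: F w != set0 -> F (v + w) = F v :&: F w.
Hypothesis F_continuous : forall v w : ballot_vec m, exists n, F (v *+ n + w) \subset F v.
Hypothesis F_convex : forall v (W W' W'' : {set 'I_m}), W \in F v -> W' \in F v ->
  #|W''| = k -> W :&: W' \subset W'' -> W'' \subset W :|: W' -> W'' \in F v.

(** * The subgroup of vectors at which all committees tie *)

Definition neutral_vec v := forall W : {set 'I_m}, #|W| = k -> W \in F v.

Lemma F_add v w W : W \in F v -> W \in F w -> F (v + w) = F v :&: F w.
Proof.
by move=> Wv Ww; apply: F_consistent; apply/set0Pn; exists W; rewrite inE Wv.
Qed.

Lemma F_ex v : exists W, W \in F v.
Proof. exact/set0Pn. Qed.

Lemma neutral_vec_closed v :
  (forall (s : {perm 'I_m}) (W : {set 'I_m}), W \in F v -> s @: W \in F v) ->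
  neutral_vec v.
Proof.
move=> Fs W Wk; have [W0 W0v] := F_ex v.
have [|s <- _] := @perm_set_transitive _ W0 W; first by rewrite Wk (F_card W0v).
exact: Fs.
Qed.

Lemma neutral_vec0 : neutral_vec 0.
Proof.
by apply: neutral_vec_closed => s W; rewrite -{2}(perm_vec0 s); apply: F_neutral.
Qed.

(** Consistency gives [F 0 = F v :&: F (- v)], and [F 0] contains every committee by symmetry. *)
Lemma neutral_vec_opp v W : W \in F v -> W \in F (- v) -> neutral_vec v.
Proof.
move=> Wv WNv U Uk; have := neutral_vec0 Uk.
by rewrite -(subrr v) (F_add Wv WNv) inE => /andP[].
Qed.

Lemma F_addr_neutral v w : neutral_vec v -> F (w + v) = F w.
Proof.
move=> Lv; have [W Ww] := F_ex w.
rewrite (F_add Ww (Lv _ (F_card Ww))); apply/setIidPl/subsetP=> U Uw.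
exact: Lv (F_card Uw).
Qed.

Lemma neutral_vecN v : neutral_vec v -> neutral_vec (- v).
Proof.
move=> Lv; have [W Wv] := F_ex (- v).
apply: (neutral_vec_opp Wv); rewrite opprK; exact: Lv (F_card Wv).
Qed.

Lemma neutral_vecD v w : neutral_vec v -> neutral_vec w -> neutral_vec (v + w).
Proof. by move=> Lv Lw W Wk; rewrite F_addr_neutral //; apply: Lv. Qed.

Lemma neutral_vecB v w : neutral_vec v -> neutral_vec w -> neutral_vec (v - w).
Proof. by move=> Lv /neutral_vecN; apply: neutral_vecD. Qed.

Lemma neutral_vecMn v n : neutral_vec v -> neutral_vec (v *+ n).
Proof.
move=> Lv; elim: n => [|n IHn]; first exact: neutral_vec0.
by rewrite mulrS; apply: neutral_vecD.
Qed.

Lemma neutral_vec_sum (I : finType) (P : pred I) (v : I -> ballot_vec m) :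
  (forall i, P i -> neutral_vec (v i)) -> neutral_vec (\sum_(i | P i) v i).
Proof.
move=> Lv; apply: (big_ind neutral_vec) => //; first exact: neutral_vec0.
exact: neutral_vecD.
Qed.

Lemma F_muln v n : (0 < n)%N -> F (v *+ n) = F v.
Proof.
case: n => // n _; elim: n => // n IHn; have [W Wv] := F_ex v.
by rewrite mulrS (F_add Wv) ?IHn ?setIid.
Qed.

Lemma neutral_vec_perm v :
  (forall s : {perm 'I_m}, neutral_vec (perm_vec s v - v)) -> neutral_vec v.
Proof.
move=> Lv; apply: neutral_vec_closed => s W Wv.
by rewrite -(F_addr_neutral v (Lv s)) addrC subrK; apply: F_neutral.
Qed.

Lemma F_perm_opp (s : {perm 'I_m}) v (W : {set 'I_m}) :
  perm_vec s v = - v -> W \in F v -> s @: W \in F (- v).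
Proof. by move=> <-; apply: F_neutral. Qed.

(* Unless [t] is neutral, a winning [W] separates [a] from [b] and [c] from [d],
   and applying both transpositions to [W] gives another winner; convexity then
   gives a winner that does not separate [c] from [d]. *)
Lemma neutral_vec_double_swap t a b c d : c != a -> c != b -> d != a -> d != b ->
  perm_vec (tperm a b) t = - t -> perm_vec (tperm c d) t = - t -> neutral_vec t.
Proof.
move=> ca cb da db; have [W Wt] := F_ex t.
wlog [aW bW] : a b ca cb da db / a \in W /\ b \notin W => [IH|].
  (* If [W] contains both or neither of [a] and [b], the transposition fixes [W], which then wins at
     [- t] as well. *)
  have [aW|aW] := boolP (a \in W); have [bW|bW] := boolP (b \in W).
  - move=> ab _; apply: (neutral_vec_opp Wt).
    by rewrite -[W](@imset_tperm_fix _ _ a b) ?aW ?bW //; apply: F_perm_opp.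
  - exact: IH.
  - by rewrite tpermC; apply: IH.
  - move=> ab _; apply: (neutral_vec_opp Wt).
    rewrite -[W](@imset_tperm_fix _ _ a b) ?(negPf aW) ?(negPf bW) //.
    exact: F_perm_opp.
wlog [cW dW] : c d ca cb da db / c \in W /\ d \notin W => [IH|].
  have [cW|cW] := boolP (c \in W); have [dW|dW] := boolP (d \in W).
  - move=> _ cd; apply: (neutral_vec_opp Wt).
    by rewrite -[W](@imset_tperm_fix _ _ c d) ?cW ?dW //; apply: F_perm_opp.
  - exact: IH.
  - by rewrite (tpermC c); apply: IH.
  - move=> _ cd; apply: (neutral_vec_opp Wt).
    rewrite -[W](@imset_tperm_fix _ _ c d) ?(negPf cW) ?(negPf dW) //.
    exact: F_perm_opp.
move=> ab cd.
have : tperm a b @: (tperm c d @: W) \in F t.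
  rewrite -[t]opprK; apply: (F_perm_opp (v := - t)).
    by rewrite perm_vecN ab.
  exact: F_perm_opp.
rewrite (imset_tperm_exchange cW dW) imset_tperm_exchange; last 2 first.
- by rewrite !inE aW andbT [a == c]eq_sym ca orbT.
- by rewrite !inE (negPf bW) andbF orbF eq_sym.
(* This intermediate committee contains neither [c] nor [d], so their transposition fixes it and it
   wins at [- t] too. *)
move=> W2t; have W3t : b |: W :\ c \in F t.
  apply: (F_convex Wt W2t).
  - by rewrite card_exchange // (F_card Wt).
  - apply/subsetP=> x; rewrite !inE => /andP[xW]; rewrite xW !andbT.
    case/orP=> [->//|/andP[_ /orP[/eqP xd|->]]]; last by rewrite orbT.
    by rewrite -xd xW in dW.
  - by apply/subsetP=> x; rewrite !inE => /orP[->|/andP[_ ->]]; rewrite /= ?orbT.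
apply: (neutral_vec_opp W3t).
rewrite -[X in X \in _](@imset_tperm_fix _ _ c d); first exact: F_perm_opp.
by rewrite !inE (negPf cb) (negPf db) eqxx (negPf dW) andbF.
Qed.

(** * Reduction of ballots to approval counts by size *)

(** Modulo neutral vectors, putting [a] in place of [b] has an effect that depends only on the size
    of the ballot. Along one exchange of [c] for [d] the difference is negated by both
    transpositions. *)
Lemma swap_vec_indep a b (Z Z' : {set 'I_m}) : #|Z| = #|Z'| ->
  a \notin Z -> b \notin Z -> a \notin Z' -> b \notin Z' ->
  neutral_vec (swap_vec a b Z - swap_vec a b Z').
Proof.
move: Z Z'; apply: exchange_ind => [Z|Z Z' c d cZ dZ cZ' dZ' IH aZ bZ aZ' bZ'].
  by rewrite subrr => *; apply: neutral_vec0.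
have ca : c != a by apply: contraNneq aZ => <-.
have cb : c != b by apply: contraNneq bZ => <-.
have da : d != a by apply: contraNneq aZ' => <-.
have db : d != b by apply: contraNneq bZ' => <-.
rewrite -(subrK (swap_vec a b (d |: Z :\ c)) (swap_vec a b Z)) -addrA.
apply: neutral_vecD; last first.
  by apply: IH; rewrite // !inE ?(negPf aZ) ?(negPf bZ) andbF orbF eq_sym.
apply: (neutral_vec_double_swap ca cb da db).
  rewrite perm_vecB !perm_swap_vec tpermL tpermR !imset_tperm_fix //.
  - by rewrite !(swap_vecN a b) [RHS]opprD.
  - by rewrite !inE (negPf aZ) (negPf bZ) !andbF ![_ == d]eq_sym (negPf da) (negPf db).
  - by rewrite (negPf aZ) (negPf bZ).
rewrite perm_vecB !perm_swap_vec !tpermD //.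
have -> : tperm c d @: (d |: Z :\ c) = Z.
  rewrite -(imset_tperm_exchange cZ dZ) -imset_comp.
  by rewrite (eq_imset _ (tpermK c d)) imset_id.
by rewrite (imset_tperm_exchange cZ dZ) [RHS]opprB.
Qed.

(* ['C(m - 2, l - 1)] is the number of sets [Z] such that [a |: Z] has size [l] and
   avoids [b], for [a != b]. *)
Definition residual_vec (S : {set 'I_m}) : ballot_vec m :=
  unit_vec S *+ 'C(m - 2, #|S|.-1) - \sum_(c in S) star_vec #|S| c.

Lemma perm_residual_vec (s : {perm 'I_m}) S :
  perm_vec s (residual_vec S) = residual_vec (s @: S).
Proof.
rewrite /residual_vec perm_vecB perm_vecMn perm_unit_vec perm_vec_sum.
rewrite card_imset; last exact: perm_inj.
rewrite big_imset /=; last by move=> x y _ _; apply: perm_inj.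
by congr (_ - _); apply: eq_bigr => c _; rewrite perm_star_vec.
Qed.

(** Exchanging [a] for [b] in [S] changes the residual by ['C(m - 2, #|S|.-1)] copies of one swap
    vector minus one swap vector for each admissible [Z]. There are exactly that many [Z], so the
    change is neutral by [swap_vec_indep], and the residual is permutation-invariant modulo neutral
    vectors. *)
Lemma residual_vec_neutral S : neutral_vec (residual_vec S).
Proof.
apply: neutral_vec_perm => s; rewrite perm_residual_vec.
have: #|s @: S| = #|S| by rewrite card_imset //; apply: perm_inj.
move: (s @: S) => S' eqS; move: S' S eqS.
apply: exchange_ind => [S|S S' a b aS bS aS' bS' IH].
  by rewrite subrr; apply: neutral_vec0.
rewrite -(subrK (residual_vec (b |: S :\ a)) (residual_vec S)) -addrA.
apply: neutral_vecD => //; rewrite /residual_vec card_exchange //.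
have neab : a != b by apply: contraNneq bS => <-.
have -> : unit_vec S *+ 'C(m - 2, #|S|.-1) - \sum_(c in S) star_vec #|S| c -
   (unit_vec (b |: S :\ a) *+ 'C(m - 2, #|S|.-1) -
    \sum_(c in b |: S :\ a) star_vec #|S| c) =
   swap_vec a b (S :\ a) *+ 'C(m - 2, #|S|.-1) - (star_vec #|S| a - star_vec #|S| b).
  rewrite (big_setD1 a aS) big_setU1 ?inE ?(negPf bS) ?andbF //=.
  have subE (x y z x' y' : ballot_vec m) :
      x - (y + z) - (x' - (y' + z)) = x - x' - (y - y').
    rewrite opprB [y' + z - x']addrC addrACA; congr (_ + _).
    by rewrite addrC opprD addrACA subrr addr0 opprB.
  by rewrite subE -mulrnBl /swap_vec setD1K.
rewrite star_vecB //; last by rewrite (cardsD1 a) aS.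
have <- : #|[set Z : {set 'I_m} | Z \subset ~: [set a; b] & #|Z| == #|S|.-1]| =
         'C(m - 2, #|S|.-1).
  by rewrite cards_draws cardsCs setCK cards2 neab card_ord.
rewrite -sumr_const -sumrB; apply: neutral_vec_sum => Z.
rewrite inE subsetC subUset !sub1set !inE => /andP[/andP[aZ bZ] /eqP Zl].
apply: swap_vec_indep => //; rewrite ?inE ?eqxx ?(negPf bS) ?andbF //.
by rewrite Zl (cardsD1 a S) aS.
Qed.

(* [weight_scale] is a common multiple of the binomials in [residual_vec], so that one
   multiple of every ballot vector decomposes integrally. *)
Definition weight_scale : nat := \prod_(j < m.-1) 'C(m - 2, j).

Definition size_scale (l : nat) : nat := (weight_scale %/ 'C(m - 2, l.-1))%N.

Lemma weight_scale_gt0 : (0 < weight_scale)%N.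
Proof.
by apply: prodn_gt0 => j; rewrite bin_gt0; have := ltn_ord j; lia.
Qed.

Lemma size_scaleE l : (0 < l < m)%N -> ('C(m - 2, l.-1) * size_scale l)%N = weight_scale.
Proof.
case: l => // l /= lm; rewrite mulnC divnK //.
have lm1 : (l < m.-1)%N by lia.
by rewrite /weight_scale (bigD1 (Ordinal lm1)) //= dvdn_mulr.
Qed.

(* [C(m - 2, m - 1) = 0], and division by zero gives zero *)
Lemma size_scale_full : size_scale m = 0%N.
Proof.
by rewrite /size_scale bin_small ?divn0 //; have := k_bounds; lia.
Qed.

(** * Vectors that single out one candidate *)

Definition size_vec := {ffun 'I_m.+1 -> int}.

(** The combination of the vectors [star_vec l c] with coefficients [x l] times [size_scale l]. It
    is symmetric in the candidates other than [c], and the scale compensates the binomial in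
    [residual_vec]. *)
Definition candidate_vec (x : size_vec) (c : 'I_m) : ballot_vec m :=
  [ffun S : {set 'I_m} =>
     if c \in S then x (inord #|S|) *+ size_scale #|S| else 0].

Lemma candidate_vecD x y c :
  candidate_vec (x + y) c = candidate_vec x c + candidate_vec y c.
Proof. by apply/ffunP=> S; rewrite !ffunE; case: ifP; rewrite ?addr0 // mulrnDl. Qed.

Lemma candidate_vecN x c : candidate_vec (- x) c = - candidate_vec x c.
Proof. by apply/ffunP=> S; rewrite !ffunE; case: ifP; rewrite ?oppr0 // mulNrn. Qed.

Lemma candidate_vecB x y c :
  candidate_vec (x - y) c = candidate_vec x c - candidate_vec y c.
Proof. by rewrite candidate_vecD candidate_vecN. Qed.

Lemma candidate_vecMn x n c : candidate_vec (x *+ n) c = candidate_vec x c *+ n.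
Proof.
apply/ffunP=> S; rewrite !(ffunE, ffunMnE); case: ifP; rewrite ?mul0rn //.
by rewrite mulrnAC.
Qed.

Lemma perm_candidate_vec (s : {perm 'I_m}) x c :
  perm_vec s (candidate_vec x c) = candidate_vec x (s c).
Proof. by apply/ffunP=> S; rewrite !ffunE inE card_preimset_perm. Qed.

Lemma sum_candidate_vec_neutral x : neutral_vec (\sum_c candidate_vec x c).
Proof.
apply: neutral_vec_perm => s; rewrite perm_vec_sum.
under eq_bigr do rewrite perm_candidate_vec.
rewrite -(reindex_inj (h := s) (F := candidate_vec x) (P := xpredT)) /=.
  by rewrite subrr; apply: neutral_vec0.
exact: perm_inj.
Qed.

Definition approval_count (v : ballot_vec m) (c : 'I_m) : size_vec :=
  [ffun l : 'I_m.+1 => \sum_(S : {set 'I_m} | (c \in S) && (#|S| == l)) v S].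

Lemma approval_countB v w c :
  approval_count (v - w) c = approval_count v c - approval_count w c.
Proof.
by apply/ffunP=> l; rewrite !ffunE -sumrB; apply: eq_bigr => S _; rewrite !ffunE.
Qed.

Definition size_unit (l : nat) : size_vec := [ffun j : 'I_m.+1 => (j == l :> nat)%:R].

Lemma approval_count_unit S c :
  approval_count (unit_vec S) c = if c \in S then size_unit #|S| else 0.
Proof.
apply/ffunP=> l; rewrite ffunE.
transitivity (((c \in S) && (#|S| == l))%:R : int).
  have [cSl|cSl] := boolP ((c \in S) && (#|S| == l)).
    rewrite (bigD1 S) //= ffunE eqxx big1 ?addr0 // => T /andP[_ neTS].
    by rewrite ffunE (negPf neTS).
  rewrite big1 // => T cTl; rewrite ffunE; case: (T =P S) cTl cSl => // ->.
  by move=> ->.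
by case: ifP; rewrite ffunE // eq_sym.
Qed.

Lemma candidate_vec_unit l c :
  (l <= m)%N -> candidate_vec (size_unit l) c = star_vec l c *+ size_scale l.
Proof.
move=> lm; apply/ffunP=> S; rewrite !(ffunE, ffunMnE).
have Sm : (#|S| < m.+1)%N by rewrite ltnS -[m in (_ <= m)%N]card_ord max_card.
rewrite inordK //; case: ifP => _; rewrite ?mul0rn //=.
by case: eqP => [->//|_]; rewrite !mul0rn.
Qed.

Lemma invariant_unit_vec_neutral (S : {set 'I_m}) :
  (forall s : {perm 'I_m}, s @: S = S) -> neutral_vec (unit_vec S).
Proof.
move=> fixS; apply: neutral_vec_perm => s; rewrite perm_unit_vec fixS subrr.
exact: neutral_vec0.
Qed.

(** The expression is additive in [v], so unit vectors suffice. For [0 < #|S| < m] it is a multiple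
    of [residual_vec S]; for the empty and the full set the sum vanishes and the unit vector is
    itself permutation-invariant. *)
Lemma approval_count_decomposition v :
  neutral_vec (v *+ weight_scale - \sum_c candidate_vec (approval_count v c) c).
Proof.
elim/ballot_vec_ind: v => [S|v w IHv IHw]; last first.
  suff -> : (v - w) *+ weight_scale -
      \sum_c candidate_vec (approval_count (v - w) c) c =
      (v *+ weight_scale - \sum_c candidate_vec (approval_count v c) c) -
      (w *+ weight_scale - \sum_c candidate_vec (approval_count w c) c).
    exact: neutral_vecB.
  under eq_bigr do rewrite approval_countB candidate_vecB.
  by rewrite sumrB mulrnBl [X in _ + X = _]opprD addrACA -opprD.
have cand0 c : candidate_vec 0 c = 0 by rewrite -(subrr 0) candidate_vecB subrr.
have Sm : (#|S| <= m)%N by rewrite -[m in (_ <= m)%N]card_ord max_card.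
have -> : \sum_c candidate_vec (approval_count (unit_vec S) c) c =
          (\sum_(c in S) star_vec #|S| c) *+ size_scale #|S|.
  rewrite -sumrMnl [RHS]big_mkcond /=; apply: eq_bigr => c _; rewrite approval_count_unit.
  by case: ifP; rewrite ?cand0 ?candidate_vec_unit.
have [Sb|Sb] := boolP (0 < #|S| < m)%N.
  rewrite -(size_scaleE Sb) mulrnA -mulrnBl.
  exact/neutral_vecMn/residual_vec_neutral.
have S0 : (\sum_(c in S) star_vec #|S| c) *+ size_scale #|S| = 0 :> ballot_vec m.
  have [S0|S0] := posnP #|S|.
    by rewrite (cards0_eq S0) big_set0 mul0rn.
  have -> : #|S| = m by lia.
  by rewrite size_scale_full mulr0n.
rewrite S0 subr0; apply/neutral_vecMn/invariant_unit_vec_neutral => s.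
have [S00|S00] := posnP #|S|; first by rewrite (cards0_eq S00) imset0.
have -> : S = setT by apply/eqP; rewrite eqEcard subsetT cardsT card_ord; lia.
by apply/eqP; rewrite eqEcard subsetT card_imset ?leqnn //; apply: perm_inj.
Qed.

(** * The preorder on size vectors *)

(** Permutations fixing the singled-out candidate fix the vector, so only membership of that
    candidate decides whether a committee wins. *)
Lemma F_candidate_transport x c c' (W W' : {set 'I_m}) : W \in F (candidate_vec x c) ->
  #|W'| = k -> (c \in W) = (c' \in W') -> W' \in F (candidate_vec x c').
Proof.
move=> Wx W'k cW; pose W1 := tperm c c' @: W.
have W1x : W1 \in F (candidate_vec x c').
  by rewrite -[c' in candidate_vec x c'](tpermL c c') -perm_candidate_vec; apply: F_neutral.
have [|s sW1 fixs] := @perm_set_transitive _ W1 W'.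
  by rewrite W'k (F_card W1x).
rewrite -sW1 -[c' in candidate_vec x c']fixs -?perm_candidate_vec; first exact: F_neutral.
by rewrite -cW -[c' in LHS](tpermL c c') mem_imset //; apply: perm_inj.
Qed.

Lemma ex_committee_mem (c : 'I_m) (b : bool) :
  exists2 W : {set 'I_m}, #|W| = k & (c \in W) = b.
Proof.
have c_card : #|~: [set c]| = m.-1 by rewrite cardsC1 card_ord.
case: b.
  have [|W Wc Wk] := @ex_subset_card _ (~: [set c]) k.-1; first by rewrite c_card; lia.
  have cW : c \notin W by apply/negP => /(subsetP Wc); rewrite !inE eqxx.
  by exists (c |: W); rewrite ?cardsU1 ?Wk ?cW ?inE ?eqxx //; lia.
have [|W Wc Wk] := @ex_subset_card _ (~: [set c]) k; first by rewrite c_card; lia.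
by exists W => //; apply/negP => /(subsetP Wc); rewrite !inE eqxx.
Qed.

(** The positive cone of the preorder: approvals [x] are at least as good for a candidate as
    none. *)
Definition favourable (x : size_vec) : Prop :=
  exists c, exists2 W : {set 'I_m}, c \in W & W \in F (candidate_vec x c).

(** By transport the winners are all committees with [c], all without [c], or all of both kinds.
    Passing from [x] to [- x] exchanges the first two outcomes and keeps the third. *)
Lemma mem_F_candidate x c (W : {set 'I_m}) : #|W| = k ->
  W \in F (candidate_vec x c) <-> favourable (if c \in W then x else - x).
Proof.
have inE_ y c' (U : {set 'I_m}) : #|U| = k -> c' \in U ->
    U \in F (candidate_vec y c') <-> favourable y.
  move=> Uk c'U; split=> [Uy|[d [V dV Vy]]]; first by exists c', U.
  by apply: (F_candidate_transport Vy); rewrite ?dV ?c'U.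
move=> Wk; case: ifPn => cW; first exact: inE_.
split=> [Wx|[d [V dV]]].
  have [V Vx] := F_ex (candidate_vec (- x) c).
  have [cV|cV] := boolP (c \in V); first by exists c, V.
  have WNx : W \in F (candidate_vec (- x) c).
    by apply: (F_candidate_transport Vx); rewrite ?(negPf cV) ?(negPf cW).
  have Lx : neutral_vec (candidate_vec (- x) c).
    by apply: (neutral_vec_opp WNx); rewrite -candidate_vecN opprK.
  have [U Uk cU] := ex_committee_mem c true.
  by exists c, U; rewrite ?cU //; apply: Lx.
move=> Vx; have [U Ux] := F_ex (candidate_vec x c).
have [cU|cU] := boolP (c \in U); last first.
  by apply: (F_candidate_transport Ux); rewrite ?(negPf cU) ?(negPf cW).
suff Lx : neutral_vec (candidate_vec x c) by apply: Lx.
apply: (neutral_vec_opp Ux); rewrite -candidate_vecN.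
by apply: (F_candidate_transport Vx); rewrite ?dV ?cU ?(F_card Ux).
Qed.

Lemma favourable0 : favourable 0.
Proof.
have c : 'I_m by apply: (@Ordinal m 0); have := k_bounds; lia.
have [W Wk cW] := ex_committee_mem c true; exists c, W; rewrite ?cW //.
rewrite -(subrr 0) candidate_vecB subrr; exact: neutral_vec0.
Qed.

Lemma favourableD x y : favourable x -> favourable y -> favourable (x + y).
Proof.
move=> [c [W cW Wx]] fy; exists c, W => //; rewrite candidate_vecD.
have Wk := F_card Wx.
have Wy : W \in F (candidate_vec y c) by apply/mem_F_candidate; rewrite ?cW.
by rewrite (F_add Wx Wy) inE Wx.
Qed.

Lemma favourable_total x : favourable x \/ favourable (- x).
Proof.
have c : 'I_m by apply: (@Ordinal m 0); have := k_bounds; lia.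
have [W Wx] := F_ex (candidate_vec x c).
have /mem_F_candidate := Wx; rewrite (F_card Wx) => /(_ erefl).
by case: ifP; [left|right].
Qed.

(** Continuity read at a committee without [c]: if it won at [y *+ n + x] for the [n] supplied, it
    would win at [y], making [- y] favourable. *)
Lemma favourable_archimedean x y : ~ favourable (- y) ->
  exists n, ~ favourable (- (y *+ n + x)).
Proof.
move=> ny; have c : 'I_m by apply: (@Ordinal m 0); have := k_bounds; lia.
have [W Wk cW] := ex_committee_mem c false.
have [n /subsetP/(_ W) Fsub] := F_continuous (candidate_vec y c) (candidate_vec x c).
exists n => fn; apply: ny.
suff /mem_F_candidate : W \in F (candidate_vec y c) by rewrite cW; apply.
apply: Fsub; rewrite -candidate_vecMn -candidate_vecD.
by apply/mem_F_candidate; rewrite ?cW.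
Qed.

(** The common winner [W0] keeps consistency applicable at every partial sum. *)
Lemma mem_F_sum (I : finType) (v : I -> ballot_vec m) (W0 W : {set 'I_m}) :
  #|W0| = k -> (forall i, W0 \in F (v i)) -> #|W| = k ->
  W \in F (\sum_i v i) <-> forall i, W \in F (v i).
Proof.
move=> W0k W0v Wk; suff [_ IH] : W0 \in F (\sum_i v i) /\
    ((W \in F (\sum_i v i)) = all (fun i => W \in F (v i)) (index_enum I)).
  rewrite IH; split=> [/allP Wv i|Wv]; last by apply/allP.
  by apply: Wv; rewrite mem_index_enum.
elim: (index_enum I) => [|i r [W0r IHr]]; rewrite ?big_nil ?big_cons.
  by rewrite !neutral_vec0.
by rewrite (F_add (W0v i) W0r) !inE W0v W0r IHr.
Qed.

(** * Representation by real weights *)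

Theorem vector_rule_representation (R : realType) : exists alpha : nat -> R,
  alpha m = 0 /\
  forall v (W : {set 'I_m}), #|W| = k ->
    W \in F v <-> forall W' : {set 'I_m}, #|W'| = k ->
      \sum_(c in W') candidate_score alpha v c <=
      \sum_(c in W) candidate_score alpha v c.
Proof.
have [phi [phiD phi_fav]] := archimedean_order_embedding R favourable0 favourableD
  favourable_total favourable_archimedean.
have phi0 : phi 0 = 0 by apply: (addIr (phi 0)); rewrite -phiD !add0r.
have phiN x : phi (- x) = - phi x.
  by apply: (addIr (phi x)); rewrite -phiD !addNr.
have phiB x y : phi (x - y) = phi x - phi y by rewrite phiD phiN.
exists (fun l => phi (size_unit l)); split.
  have c : 'I_m by apply: (@Ordinal m 0); have := k_bounds; lia.
  have [W Wk cW] := ex_committee_mem c true.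
  (* Full ballots have scale 0, so [size_unit m] yields the zero vector and both signs are
     favourable. *)
  have fav b : favourable (if b then size_unit m else - size_unit m).
    have [U Uk <-] := ex_committee_mem c b; apply/mem_F_candidate => //.
    by rewrite candidate_vec_unit // size_scale_full; apply: neutral_vec0.
  apply/eqP; rewrite eq_le -oppr_ge0 -phiN.
  by rewrite (iffLR (phi_fav _) (fav false)) (iffLR (phi_fav _) (fav true)).
move=> v W Wk; pose g c := phi (approval_count v c).
have gE c : candidate_score (fun l => phi (size_unit l)) v c = g c.
  rewrite /g /candidate_score; elim/ballot_vec_ind: v {g} => [S|v w IHv IHw]; last first.
    rewrite approval_countB phiB -IHv -IHw -sumrB; apply: eq_bigr => S _.
    by rewrite !ffunE rmorphB mulrBr.
  rewrite approval_count_unit; have [cS|cS] := boolP (c \in S).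
    rewrite (bigD1 S) //= ffunE eqxx mulr1 big1 ?addr0 // => T /andP[_ neTS].
    by rewrite ffunE (negPf neTS) mulr0.
  rewrite phi0 big1 // => T cT; rewrite ffunE; case: eqP => [eTS|_].
    by rewrite eTS (negPf cS) in cT.
  by rewrite mulr0.
have [|a0 [W0 W0k W0g]] := @topk_threshold R _ k g; first by rewrite card_ord; lia.
(* After subtracting the approvals of the threshold candidate, all summands have the common winner
   [W0], so the sum can be treated one candidate at a time. *)
pose theta := approval_count v a0.
have FvE : F v = F (\sum_c candidate_vec (approval_count v c - theta) c).
  have -> : \sum_c candidate_vec (approval_count v c - theta) c =
    v *+ weight_scale + - (v *+ weight_scale - \sum_c candidate_vec (approval_count v c) c)
      + - \sum_c candidate_vec theta c.
    under eq_bigr do rewrite candidate_vecB.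
    by rewrite sumrB opprB addrCA subrr addr0.
  rewrite !F_addr_neutral ?F_muln //; first exact: weight_scale_gt0.
  - exact/neutral_vecN/approval_count_decomposition.
  - exact/neutral_vecN/sum_candidate_vec_neutral.
have memE (U : {set 'I_m}) c : #|U| = k ->
    U \in F (candidate_vec (approval_count v c - theta) c) <->
    if c \in U then g a0 <= g c else g c <= g a0.
  move=> Uk; rewrite mem_F_candidate // phi_fav; case: ifP => _.
    by rewrite phiB subr_ge0.
  by rewrite opprB phiB subr_ge0.
have W0F c : W0 \in F (candidate_vec (approval_count v c - theta) c) by apply/memE.
rewrite FvE (mem_F_sum W0k W0F Wk).
transitivity (forall c, if c \in W then g a0 <= g c else g c <= g a0).
  by split=> WF c; apply/memE.
rewrite (threshold_argmax W0k W0g Wk).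
have sumE (U : {set 'I_m}) :
    \sum_(c in U) candidate_score (fun l => phi (size_unit l)) v c =
    \sum_(c in U) g c by apply: eq_bigr => c _.
by split=> Wmax U Uk; have := Wmax U Uk; rewrite !sumE.
Qed.

End VectorRule.

(** * Ballot counts of profiles *)

Section BallotCount.

Variable m : nat.
Implicit Types (A B C : profile m) (S : {set 'I_m}).

Definition ballot_count A : ballot_vec m :=
  [ffun S => (count (fun i => look A i == Some S) (enum_fset (electorate A)))%:Z].

Lemma mem_electorate A i : (i \in electorate A) = (look A i != None).
Proof. by rewrite /electorate /look; case: fndP. Qed.

Lemma look_neq0 A i S : look A i = Some S -> S != set0.
Proof.
rewrite /look; case: fndP => // iA [<-].
by have /andP[_ /forallP] := valP A; apply.
Qed.

Lemma electorate_ex A : exists i, look A i != None.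
Proof.
have /andP[/fset0Pn[i iA] _] := valP A; exists i.
by rewrite -mem_electorate.
Qed.

Lemma profile_ex (D : {fset nat}) (h : nat -> option {set 'I_m}) :
  (exists i, h i != None) -> (forall i, h i != None -> i \in D) ->
  (forall i S, h i = Some S -> S != set0) ->
  exists A, forall i, look A i = h i.
Proof.
move=> [i0 hi0] hD h_neq0.
pose E := [fset i in D | h i != None]%fset.
pose A : rawprof m := [fmap i : E => odflt set0 (h (val i))]%fmap.
have iE i : (i \in E) = (h i != None).
  by rewrite !inE /=; case: (boolP (h i != None)) => [/hD ->|]; rewrite ?andbF.
have A_ok : valid_prof A.
  apply/andP; split; first by apply/fset0Pn; exists i0; rewrite iE.
  apply/forallP=> i; rewrite ffunE.
  have := valP i; rewrite iE; case hi: (h _) => [S|] //= _.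
  exact: h_neq0 hi.
exists (exist _ A A_ok) => i; rewrite /look /=.
case: fndP => [iA|]; rewrite ?ffunE /=.
  by move: (iA); rewrite iE; case: (h i).
by rewrite iE negbK => /eqP ->.
Qed.

Lemma ballot_countE A (s : seq nat) S : uniq s ->
  (forall i, look A i != None -> i \in s) ->
  ballot_count A S = (count (fun i => look A i == Some S) s)%:Z.
Proof.
move=> s_uniq sA; rewrite ffunE; congr Posz; rewrite -!size_filter.
apply/perm_size/uniq_perm; rewrite ?filter_uniq ?fset_uniq // => i.
rewrite !mem_filter; case: eqP => //= iS.
by rewrite -[LHS]/(i \in electorate A) mem_electorate sA // iS.
Qed.

Lemma ballot_count_set0 A : ballot_count A set0 = 0.
Proof.
rewrite ffunE; apply/eqP; rewrite eqz_nat -leqn0 leqNgt -has_count.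
by apply/negP => /hasP[i _ /eqP/look_neq0]; rewrite eqxx.
Qed.

Lemma electorate_bound A : exists M, forall i, look A i != None -> (i < M)%N.
Proof.
exists (\max_(i <- enum_fset (electorate A)) i).+1 => i iA.
by rewrite ltnS; apply: leq_bigmax_seq; rewrite // mem_electorate.
Qed.

Lemma ballot_count_anonymous (pi pinv : nat -> nat) A B :
  cancel pi pinv -> cancel pinv pi -> (forall j, look B j = look A (pinv j)) ->
  ballot_count A = ballot_count B.
Proof.
move=> piK pinvK BA; apply/ffunP=> S.
rewrite (@ballot_countE B (map pi (enum_fset (electorate A)))).
- rewrite ffunE count_map; congr Posz; apply: eq_count => i /=.
  by rewrite BA piK.
- by rewrite map_inj_uniq ?fset_uniq //; apply: can_inj piK.
- move=> i iB; apply/mapP; exists (pinv i); last by rewrite pinvK.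
  by rewrite mem_electorate -BA.
Qed.

Lemma sum_count_mem (T : finType) (s : seq T) : (\sum_x count_mem x s)%N = size s.
Proof.
elim: s => [|y s IHs] /=; first by rewrite big1.
rewrite big_split /= IHs (bigD1 y) //= eqxx big1 // => x.
by rewrite eq_sym => /negPf ->.
Qed.

(** Voters below a common bound [M] form a tuple of optional ballots, absent voters being [None].
    Equal ballot counts force equal [None] counts, so the tuples are rearrangements of each other.
    The permutation is extended by the identity, as anonymity asks for one of all of [nat]. *)
Lemma same_ballot_count_permutation A B : ballot_count A = ballot_count B ->
  exists pi pinv : nat -> nat, [/\ cancel pi pinv, cancel pinv pi &
    forall j, look B j = look A (pinv j)].
Proof.
move=> eqAB; have [MA ltMA] := electorate_bound A; have [MB ltMB] := electorate_bound B.
pose M := maxn MA MB.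
have ltA i : look A i != None -> (i < M)%N by move/ltMA => h; rewrite leq_max h.
have ltB i : look B i != None -> (i < M)%N by move/ltMB => h; rewrite leq_max h orbT.
pose t C := [tuple look C (i : 'I_M) | i < M].
have tE C S : (forall i, look C i != None -> (i < M)%N) ->
    (count_mem (Some S) (t C))%:Z = ballot_count C S.
  move=> ltC; rewrite (@ballot_countE C (iota 0 M)) ?iota_uniq //; last first.
    by move=> i /ltC; rewrite mem_iota.
  by rewrite -val_enum_ord !count_map.
have eqSome S : count_mem (Some S) (t A) = count_mem (Some S) (t B).
  by apply/eqP; rewrite -eqz_nat !tE // eqAB.
have eqNone : count_mem None (t A) = count_mem None (t B).
  have : (\sum_x count_mem x (t A) = \sum_x count_mem x (t B))%N.
    by rewrite !sum_count_mem !size_tuple.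
  rewrite (bigD1 None) // [in RHS](bigD1 None) //=.
  by rewrite (eq_bigr (fun x => count_mem x (t B))) => [/addIn //|[S|] //].
have /tuple_permP[p tAp] : perm_eq (t A) (t B).
  by apply/allP => -[S|] _ /=; rewrite ?eqSome ?eqNone.
have lookAp (i : 'I_M) : look A i = look B (p i).
  have : tnth (t A) i = tnth [tuple tnth (t B) (p j) | j < M] i.
    by congr tnth; apply: val_inj.
  by rewrite !tnth_mktuple.
pose ext (q : {perm 'I_M}) j := oapp (fun i => val (q i)) j (insub j).
have extK q : cancel (ext q) (ext q^-1%g).
  move=> j; rewrite /ext; case: insubP => [i _ <-|/negPf jM] /=.
    by rewrite valK /= permK.
  by rewrite insubF.
exists (ext p), (ext p^-1%g); split=> [||j]; first exact: extK.
  by move=> j; have := extK p^-1%g j; rewrite invgK.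
rewrite /ext; case: insubP => [i _ <-|jM] /=; first by rewrite lookAp permKV.
have noneE C : (forall i, look C i != None -> (i < M)%N) -> look C j = None.
  by move=> ltC; apply/eqP; apply: contraNT jM => /ltC.
by rewrite !noneE.
Qed.

Lemma ballot_count_neutral (s : {perm 'I_m}) A B :
  (forall i, look B i = omap (fun S : {set 'I_m} => s @: S) (look A i)) ->
  ballot_count B = perm_vec s (ballot_count A).
Proof.
move=> BA; apply/ffunP=> S; rewrite (@ballot_countE B (enum_fset (electorate A))).
- rewrite !ffunE; congr Posz; apply: eq_count => i /=; rewrite BA.
  case: (look A i) => //= X.
  by rewrite /eq_op /= [RHS]eq_sym preimset_perm_eq eq_sym.
- exact: fset_uniq.
- by move=> i; rewrite BA mem_electorate; case: (look A i).
Qed.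

Lemma ballot_count_sum A A' B : disjoint_prof A A' -> is_sum A A' B ->
  ballot_count B = ballot_count A + ballot_count A'.
Proof.
move=> dAA' sumB; have disj i : i \in electorate A' -> i \notin electorate A.
  move=> iA'; apply/negP => iA.
  have : i \in (electorate A `&` electorate A')%fset by rewrite inE iA.
  by rewrite dAA' inE.
apply/ffunP=> S; rewrite [RHS]ffunE.
rewrite (@ballot_countE B (enum_fset (electorate A) ++ enum_fset (electorate A'))).
- rewrite count_cat PoszD !ffunE; congr (Posz _ + Posz _); apply: eq_in_count => i iA /=.
    by rewrite sumB [_ \in _]iA.
  by rewrite sumB (negPf (disj i iA)).
- rewrite cat_uniq !fset_uniq andbT /=; apply/hasPn => i /disj //.
- move=> i; rewrite mem_cat sumB.
  rewrite -[i \in enum_fset (electorate A)]/(i \in electorate A).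
  by case: ifP => // _; rewrite -mem_electorate.
Qed.

Lemma ballot_count_copies lam A C : is_copies lam A C ->
  ballot_count C = ballot_count A *+ lam.
Proof.
move=> [sigma [sigma_inj memC lookC]]; apply/ffunP=> S; rewrite ffunMnE.
pose s := [seq sigma t i | t <- iota 0 lam, i <- enum_fset (electorate A)].
rewrite (@ballot_countE C s).
- rewrite count_flatten -map_comp ffunE.
  have countE t : t \in iota 0 lam ->
      (count (fun i => look C i == Some S) \o
        (fun t => [seq sigma t i | i <- enum_fset (electorate A)])) t =
      count (fun i => look A i == Some S) (enum_fset (electorate A)).
    rewrite mem_iota /= => tl; rewrite count_map; apply: eq_in_count => i iA /=.
    by rewrite lookC.
  rewrite (iffLR (eq_in_map _ _ _) countE) sumnE big_map big_const_seq count_predT size_iota.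
  by rewrite iter_addn_0 PoszM -mulr_natr natz.
- apply: allpairs_uniq; rewrite ?iota_uniq ?fset_uniq //.
  move=> [t i] [t' i'] /allpairsP[[t1 i1] /= [t1l i1A [-> ->]]].
  move=> /allpairsP[[t2 i2] /= [t2l i2A [-> ->]]] /sigma_inj.
  rewrite !mem_iota in t1l t2l.
  by case/(_ t1l t2l i1A i2A) => -> ->.
- move=> j; rewrite -mem_electorate => /memC[t [i [tl iA ->]]].
  by apply: allpairs_f; rewrite ?mem_iota.
Qed.

(** * Profiles with prescribed voters or counts *)

Lemma shift_profile A M : exists2 A', ballot_count A' = ballot_count A &
  forall i, i \in electorate A' -> (M <= i)%N.
Proof.
have [MA ltMA] := electorate_bound A.
pose h i := if (M <= i)%N then look A (i - M) else None.
have [||i S|A' A'E] := @profile_ex [fset i in iota M MA]%fset h.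
- by have [i iA] := electorate_ex A; exists (M + i)%N; rewrite /h leq_addr addKn.
- by move=> i; rewrite /h; case: ifP => // Mi /ltMA; rewrite inE mem_iota Mi /=; lia.
- by rewrite /h; case: ifP => // _; apply: look_neq0.
exists A' => [|i]; last by rewrite mem_electorate A'E /h; case: ifP.
apply/ffunP=> S; rewrite (@ballot_countE A' (map (addn M) (enum_fset (electorate A)))).
- rewrite ffunE count_map; congr Posz; apply: eq_count => i /=.
  by rewrite A'E /h leq_addr addKn.
- by rewrite map_inj_uniq ?fset_uniq //; apply: addnI.
- move=> i; rewrite A'E /h; case: ifP => // Mi iA; apply/mapP; exists (i - M)%N.
    by rewrite mem_electorate.
  by rewrite subnKC.
Qed.

Lemma sum_profile A A' : disjoint_prof A A' -> exists B, is_sum A A' B.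
Proof.
move=> dAA'.
have [||i S|B BE] := @profile_ex (electorate A `|` electorate A')%fset
    (fun i => if i \in electorate A then look A i else look A' i).
- by have [i iA] := electorate_ex A; exists i; rewrite mem_electorate iA.
- by move=> i; rewrite inE; case: ifP => // _; rewrite -mem_electorate.
- by case: ifP => _; apply: look_neq0.
by exists B.
Qed.

Lemma copies_profile lam A M : (0 < lam)%N -> exists2 C, is_copies lam A C &
  forall i, i \in electorate C -> (M <= i)%N.
Proof.
move=> lam0; have [N ltN] := electorate_bound A.
have N0 : (0 < N)%N by have [i /ltN] := electorate_ex A; lia.
(* Copy [t] of voter [i] sits at [M + (t * N + i)]; as [N] exceeds every voter, division by [N]
   recovers [t] and [i]. *)
pose h j := if (M <= j < M + lam * N)%N then look A ((j - M) %% N) else None.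
have h_copy t i : (t < lam)%N -> i \in electorate A -> h (M + (t * N + i))%N = look A i.
  move=> tl; rewrite mem_electorate => /ltN iN.
  by rewrite /h leq_addr /= addKn modnMDl modn_small // ifT //; nia.
have [||j S|C CE] := @profile_ex [fset i in iota M (lam * N)]%fset h.
- have [i iA] := electorate_ex A; exists (M + (0 * N + i))%N.
  by rewrite h_copy // mem_electorate.
- by move=> j; rewrite /h; case: ifP => // jM _; rewrite inE mem_iota.
- by rewrite /h; case: ifP => // _; apply: look_neq0.
exists C => [|j]; last by rewrite mem_electorate CE /h; case: ifP => // /andP[].
exists (fun t i => M + (t * N + i))%N; split.
- move=> t t' i i' _ _; rewrite !mem_electorate => /ltN iN /ltN i'N /addnI e.
  have: ((t * N + i) %/ N = (t' * N + i') %/ N)%N by rewrite e.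
  rewrite !divnMDl // !divn_small // !addn0 => tt'.
  by split=> //; move: e; rewrite tt' => /addnI.
- move=> j; split=> [|[t [i [tl iA ->]]]]; last first.
    by rewrite mem_electorate CE h_copy // -mem_electorate.
  rewrite mem_electorate CE /h; case: ifP => // /andP[Mj jM] iA.
  exists ((j - M) %/ N)%N, ((j - M) %% N)%N; split.
  + by rewrite ltn_divLR //; lia.
  + by rewrite mem_electorate.
  + by rewrite -divn_eq subnKC.
- by move=> t i tl iA; rewrite CE h_copy.
Qed.

Lemma ballot_count_surj (v : ballot_vec m) : (forall S, S != set0 -> 0 <= v S) ->
  (exists2 S, S != set0 & v S != 0) ->
  exists A, forall S, S != set0 -> ballot_count A S = v S.
Proof.
move=> v0 [S0 S00 vS0].
pose s := flatten [seq nseq `|v X|%N X | X <- enum [pred X : {set 'I_m} | X != set0]].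
have sE S : S != set0 -> count_mem S s = `|v S|%N.
  move=> S_neq0; rewrite count_flatten -map_comp sumnE big_map big_enum /= (bigD1 S) //=.
  rewrite count_nseq /= eqxx mul1n big1 ?addn0 // => T /andP[_ /negPf neTS].
  by rewrite count_nseq /= neTS.
have s_neq0 S : S \in s -> S != set0.
  case/flatten_mapP=> T; rewrite mem_enum inE => T0 /nseqP[->] //.
have [||i S|A AE] := @profile_ex [fset i in iota 0 (size s)]%fset (onth s).
- have : S0 \in s by rewrite -has_pred1 has_count sE // absz_gt0.
  by case/onthP=> i iS; exists i; rewrite iS.
- move=> i; rewrite inE mem_iota /= add0n -onthTE; by case: (onth s i).
- by move=> iS; apply: s_neq0; apply/onthP; exists i.
exists A => S S_neq0; rewrite -[RHS]gez0_abs ?v0 // -sE //.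
rewrite (@ballot_countE A (iota 0 (size s))) ?iota_uniq // => [|i]; last first.
  by rewrite AE mem_iota /= add0n -onthTE; case: (onth s i).
congr Posz; transitivity (count_mem (Some S) (map Some s)).
  rewrite -[map Some s](@take_size) -(@map_nth_iota0 _ None) // count_map size_map.
  by apply: eq_count => i /=; rewrite AE onthE.
by rewrite count_map; apply: eq_count => X /=; rewrite /eq_op.
Qed.

(** Double counting: voters are grouped by ballot, and [#|S :&: W|] is spread over the candidates in
    [W]. *)
Lemma bswav_scoreE (R : realType) (alpha : nat -> R) A (W : {set 'I_m}) :
  bswav_score alpha A W = \sum_(c in W) candidate_score alpha (ballot_count A) c.
Proof.
pose G (S : {set 'I_m}) : R := alpha #|S| * #|S :&: W|%:R.
have -> : bswav_score alpha A W = \sum_(i <- enum_fset (electorate A))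
    \sum_(S : {set 'I_m} | look A i == Some S) G S.
  rewrite /bswav_score big_seq_fsetE; apply: eq_bigr => i _ /=.
  by rewrite /look -Some_fnd (big_pred1 (val A i)) // => S.
rewrite (exchange_big_dep xpredT) //= [RHS](exchange_big_dep xpredT) //=.
apply: eq_bigr => S _.
rewrite [RHS](eq_bigl (mem (S :&: W))); last by move=> c; rewrite !inE andbC.
rewrite big_const_seq iter_addr_0 sumr_const ffunE /G.
by rewrite -[LHS]mulr_natr -[RHS]mulr_natr -pmulrn mulrAC.
Qed.

End BallotCount.

(** * From rules on profiles to rules on ballot vectors *)

Lemma perm_profile m (s : {perm 'I_m}) (A : profile m) : exists B : profile m,
  forall i, look B i = omap (fun S : {set 'I_m} => s @: S) (look A i).
Proof.
apply: (profile_ex (D := electorate A)) => [|i|i S].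
- by have [i iA] := electorate_ex A; exists i; case: (look A i) iA.
- by rewrite mem_electorate; case: (look A i).
- case iA: (look A i) => [X|] //= [<-].
  by rewrite -card_gt0 card_imset ?card_gt0 ?(look_neq0 iA) //; apply: perm_inj.
Qed.

Lemma disjoint_prof_bound m (A B : profile m) M :
  (forall i, look A i != None -> (i < M)%N) ->
  (forall i, i \in electorate B -> (M <= i)%N) -> disjoint_prof A B.
Proof.
move=> ltA geB; apply/fsetP=> i; rewrite !inE; apply/negbTE/negP => /andP[].
by rewrite mem_electorate => /ltA iM /geB; rewrite leqNgt iM.
Qed.

Lemma single_profile m (S : {set 'I_m}) : S != set0 -> exists A : profile m,
  [/\ ballot_count A = unit_vec S & forall i X, look A i = Some X -> X = S].
Proof.
move=> S0; have [||i X|A AE] := @profile_ex m [fset 0%N]%fset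
    (fun i => if i == 0%N then Some S else None).
- by exists 0%N.
- by move=> i; rewrite in_fset1; case: (i =P 0%N).
- by case: eqP => // _ [<-].
exists A; split=> [|i X]; last by rewrite AE; case: eqP => // _ [].
apply/ffunP=> X; rewrite (@ballot_countE m A [:: 0%N]) // => [|i]; last first.
  by rewrite AE inE; case: (i =P 0%N).
by rewrite /= AE eqxx addn0 ffunE [X == S]eq_sym (inj_eq Some_inj); case: eqP.
Qed.

Section RuleToVector.

Variables (m k : nat) (f : profile m -> {set {set 'I_m}}).
Hypothesis k_bounds : (0 < k < m)%N.
Hypothesis f_rule : is_ABC_rule k f.
Hypothesis f_anonymous : anonymous f.
Hypothesis f_neutral : neutral f.
Hypothesis f_consistent : consistent f.
Hypothesis f_continuous : continuous f.
Hypothesis f_convex : choice_set_convex k f.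

Lemma f_ballot_count A B : ballot_count A = ballot_count B -> f A = f B.
Proof.
move/same_ballot_count_permutation => [pi [pinv [piK pinvK BA]]].
exact: (f_anonymous piK pinvK BA).
Qed.

Lemma f_ballot_count_add A A' : exists2 B,
  ballot_count B = ballot_count A + ballot_count A' &
  f A :&: f A' != set0 -> f B = f A :&: f A'.
Proof.
have [M ltM] := electorate_bound A; have [A'' A''E geM] := shift_profile A' M.
have dAA'' := disjoint_prof_bound ltM geM.
have [B sumB] := sum_profile dAA''.
exists B; first by rewrite (ballot_count_sum dAA'' sumB) A''E.
by rewrite -(f_ballot_count A''E); apply: f_consistent.
Qed.

(** Renaming candidates permutes the ballots but leaves equal counts unchanged, so the winners are
    closed under all permutations. *)
Lemma uniform_profile n : (0 < n)%N -> exists2 U : profile m,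
  (forall S, S != set0 -> ballot_count U S = n%:Z) &
  forall W : {set 'I_m}, #|W| = k -> W \in f U.
Proof.
move=> n0; have [||U UE] := @ballot_count_surj m [ffun=> n%:Z].
- by move=> S _; rewrite ffunE.
- exists setT; last by rewrite ffunE eqz_nat -lt0n.
  by rewrite -card_gt0 cardsT card_ord; lia.
exists U => [S S0|W Wk]; first by rewrite UE // ffunE.
have [/set0Pn[W0 W0U] fU_card] := f_rule U.
have [|s <- _] := @perm_set_transitive _ W0 W; first by rewrite Wk fU_card.
have [B BE] := perm_profile s U; have := f_neutral BE.
rewrite -(@f_ballot_count U B) => [->|]; first exact: imset_f.
rewrite (ballot_count_neutral BE); apply/ffunP=> S; rewrite [RHS]ffunE.
have [->|S0] := eqVneq S set0; first by rewrite preimset0.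
rewrite !UE ?ffunE //; first by rewrite -card_gt0 card_preimset_perm card_gt0.
Qed.

(* Uniform profiles are neutral, so adding one lets every integer vector,
   including those with negative entries, stand for a profile. *)
Definition represents (A : profile m) (v : ballot_vec m) : Prop :=
  exists M : nat, forall S : {set 'I_m}, S != set0 -> ballot_count A S = v S + M%:Z.

Lemma represents_ex v : exists A, represents A v.
Proof.
(* The successor makes every entry [v S + M] positive, so the electorate is non-empty even for
   [v = 0]. *)
pose M := (\sum_S `|v S|%N).+1.
have gt0 S : 0 < v S + M%:Z.
  have: (`|v S| <= \sum_S `|v S|)%N by rewrite (bigD1 S) //= leq_addr.
  by rewrite /M; lia.
have [||A AE] := @ballot_count_surj m [ffun S => v S + M%:Z].
- by move=> S _; rewrite ffunE ltW.
- exists setT; last by rewrite ffunE gt_eqF.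
  by rewrite -card_gt0 cardsT card_ord; lia.
by exists A, M => S S0; rewrite AE // ffunE.
Qed.

Lemma f_add_uniform A n : exists2 B,
  (forall S, S != set0 -> ballot_count B S = ballot_count A S + n.+1%:Z) & f B = f A.
Proof.
have [U UE fU] := uniform_profile (ltn0Sn n).
have [B BE fB] := f_ballot_count_add A U.
exists B => [S S0|]; first by rewrite BE ffunE UE.
have [/set0Pn[W WA] fA_card] := f_rule A.
rewrite fB; last by apply/set0Pn; exists W; rewrite inE WA fU // fA_card.
by apply/setIidPl/subsetP=> V VA; rewrite fU // fA_card.
Qed.

Lemma represents_unique A B v : represents A v -> represents B v -> f A = f B.
Proof.
move=> [MA AE] [MB BE].
(* Adding the offset of the other profile brings both counts to [v S + MA + MB + 1]; the extra 1
   keeps the added uniform profile non-empty. *)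
have [A' A'E <-] := f_add_uniform A MB; have [B' B'E <-] := f_add_uniform B MA.
apply: f_ballot_count; apply/ffunP=> S.
have [->|S0] := eqVneq S set0; first by rewrite !ballot_count_set0.
by rewrite A'E // B'E // AE // BE //; lia.
Qed.

(** The last clause transfers to [F] the properties of single choice sets: non-emptiness, committee
    size and convexity. *)
Lemma vector_extension : exists F : ballot_vec m -> {set {set 'I_m}},
  [/\ forall A, F (ballot_count A) = f A,
      forall (s : {perm 'I_m}) v (W : {set 'I_m}), W \in F v -> s @: W \in F (perm_vec s v),
      forall v w, F v :&: F w != set0 -> F (v + w) = F v :&: F w,
      forall v w : ballot_vec m, exists n, F (v *+ n + w) \subset F v &
      forall v, exists A, F v = f A].
Proof.
have [prof profE] := choice represents_ex.
have fE A v : represents A v -> f (prof v) = f A.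
  by move=> rA; apply: represents_unique (profE v) rA.
exists (fun v => f (prof v)); split=> [A|s v W Wv|v w|v w|v].
- by apply: fE; exists 0%N => S _; rewrite addr0.
- have [B BE] := perm_profile s (prof v); rewrite (fE B).
    by rewrite (f_neutral BE) imset_f.
  have [M ME] := profE v; exists M => S S0.
  by rewrite (ballot_count_neutral BE) !ffunE -ME ?ffunE //
             -card_gt0 card_preimset_perm card_gt0.
- have [B BE fB] := f_ballot_count_add (prof v) (prof w) => /fB <-; apply: fE.
  have [M ME] := profE v; have [M' M'E] := profE w; exists (M + M')%N => S S0.
  by rewrite BE [LHS]ffunE ME // M'E // ffunE PoszD addrACA.
- have [n n0 f_sub] := f_continuous (prof v) (prof w); exists n.
  have [N ltN] := electorate_bound (prof w).
  have [C copyC geC] := copies_profile (prof v) N n0.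
  have dC : disjoint_prof C (prof w).
    by rewrite /disjoint_prof fsetIC; apply: disjoint_prof_bound ltN geC.
  have [B sumB] := sum_profile dC.
  rewrite (fE B); first exact: f_sub sumB.
  have [M ME] := profE v; have [M' M'E] := profE w; exists (M * n + M')%N => S S0.
  rewrite (ballot_count_sum dC sumB) (ballot_count_copies copyC) [LHS]ffunE ffunMnE.
  have MnE : (M * n)%N%:Z = M%:Z *+ n by rewrite PoszM -mulr_natr natz.
  by rewrite ME // M'E // [in RHS]ffunE [in RHS]ffunMnE mulrnDl PoszD MnE addrACA.
- by exists (prof v).
Qed.

Lemma axioms_representation (R : realType) : exists alpha : nat -> R,
  alpha m = 0 /\
  forall A (W : {set 'I_m}), #|W| = k ->
    W \in f A <-> forall W' : {set 'I_m}, #|W'| = k ->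
      bswav_score alpha A W' <= bswav_score alpha A W.
Proof.
have [F [FE F_neutral F_cons F_cont F_im]] := vector_extension.
have [||v W W' W''|alpha [alpha_m alphaP]] := @vector_rule_representation
    m k F k_bounds _ _ F_neutral F_cons F_cont _ R.
- by move=> v; have [A ->] := F_im v; have [] := f_rule A.
- by move=> v W; have [A ->] := F_im v; have [_] := f_rule A; apply.
- by have [A ->] := F_im v; apply: f_convex.
exists alpha; split=> // A W Wk; rewrite -FE alphaP //.
by split=> Wmax W' /Wmax; rewrite !bswav_scoreE.
Qed.

End RuleToVector.

(** * Properties of BSWAV rules *)

Lemma candidate_scoreD (R : realType) m (alpha : nat -> R) (v w : ballot_vec m) c :
  candidate_score alpha (v + w) c = candidate_score alpha v c + candidate_score alpha w c.
Proof.
rewrite /candidate_score -big_split /=; apply: eq_bigr => S _.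
by rewrite ffunE rmorphD mulrDr.
Qed.

Lemma candidate_scoreMn (R : realType) m (alpha : nat -> R) (v : ballot_vec m) n c :
  candidate_score alpha (v *+ n) c = candidate_score alpha v c *+ n.
Proof.
rewrite /candidate_score -sumrMnl; apply: eq_bigr => S _.
by rewrite ffunMnE rmorphMn mulrnAr.
Qed.

Lemma candidate_score_perm (R : realType) m (alpha : nat -> R) (v : ballot_vec m)
    (s : {perm 'I_m}) c :
  candidate_score alpha (perm_vec s v) (s c) = candidate_score alpha v c.
Proof.
rewrite /candidate_score (reindex_inj (h := fun S : {set 'I_m} => s @: S)) /=.
  apply: eq_big => S; first by rewrite mem_imset //; apply: perm_inj.
  rewrite ffunE card_imset; last exact: perm_inj.
  by rewrite (eqP (_ : s @^-1: (s @: S) == S)) // preimset_perm_eq.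
exact/imset_inj/perm_inj.
Qed.

Lemma candidate_score_unit (R : realType) m (alpha : nat -> R) (S : {set 'I_m}) c :
  candidate_score alpha (unit_vec S) c = if c \in S then alpha #|S| else 0.
Proof.
rewrite /candidate_score; case: ifP => cS.
  rewrite (bigD1 S) //= ffunE eqxx mulr1 big1 ?addr0 // => T /andP[_ neTS].
  by rewrite ffunE (negPf neTS) mulr0.
rewrite big1 // => T cT; rewrite ffunE; case: eqP => [eTS|_]; last by rewrite mulr0.
by rewrite eTS cS in cT.
Qed.

Lemma bswav_score_sum (R : realType) m (alpha : nat -> R) (A A' B : profile m) W :
  disjoint_prof A A' -> is_sum A A' B ->
  bswav_score alpha B W = bswav_score alpha A W + bswav_score alpha A' W.
Proof.
move=> dA sB; rewrite !bswav_scoreE (ballot_count_sum dA sB) -big_split /=.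
by apply: eq_bigr => c _; rewrite candidate_scoreD.
Qed.

Lemma bswav_score_copies (R : realType) m (alpha : nat -> R) lam (A C : profile m) W :
  is_copies lam A C -> bswav_score alpha C W = bswav_score alpha A W *+ lam.
Proof.
move=> cC; rewrite !bswav_scoreE (ballot_count_copies cC) -sumrMnl.
by apply: eq_bigr => c _; rewrite candidate_scoreMn.
Qed.

Lemma bswav_score_perm (R : realType) m (alpha : nat -> R) (s : {perm 'I_m})
    (A B : profile m) (W : {set 'I_m}) :
  (forall i, look B i = omap (fun S : {set 'I_m} => s @: S) (look A i)) ->
  bswav_score alpha B (s @: W) = bswav_score alpha A W.
Proof.
move=> BA; rewrite !bswav_scoreE (ballot_count_neutral BA).
rewrite big_imset /=; last by move=> x y _ _; apply: perm_inj.
by apply: eq_bigr => c _; rewrite candidate_score_perm.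
Qed.

Lemma bswav_score_exchange (R : realType) m (alpha : nat -> R) (A : profile m)
    (W : {set 'I_m}) a b : a \in W -> b \notin W ->
  bswav_score alpha A (b |: W :\ a) = bswav_score alpha A W
    + (candidate_score alpha (ballot_count A) b - candidate_score alpha (ballot_count A) a).
Proof.
move=> aW bW; rewrite !bswav_scoreE (big_setD1 a aW) /=.
rewrite big_setU1 ?inE ?(negPf bW) ?andbF //=.
lra.
Qed.

Definition bswav_winner (R : realType) m (k : nat) (alpha : nat -> R) (A : profile m)
    (W : {set 'I_m}) : Prop :=
  #|W| = k /\ forall W' : {set 'I_m}, #|W'| = k ->
    bswav_score alpha A W' <= bswav_score alpha A W.

Section BSWAVAxioms.

Variables (R : realType) (m k : nat) (f : profile m -> {set {set 'I_m}}).
Variable alpha : nat -> R.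
Hypothesis alpha_ge0 : forall j, (0 < j <= m)%N -> 0 <= alpha j.
Hypothesis f_rule : is_ABC_rule k f.
Hypothesis fP : forall A W, W \in f A <-> bswav_winner k alpha A W.

Lemma bswav_anonymous : anonymous f.
Proof.
move=> pi pinv A B piK pinvK BA.
apply/setP=> W; apply/idP/idP => /fP[Wk Wmax]; apply/fP; split=> // W' /Wmax;
by rewrite !bswav_scoreE (ballot_count_anonymous piK pinvK BA).
Qed.

Lemma bswav_neutral : neutral f.
Proof.
move=> s A B BA; have scoreE := bswav_score_perm alpha _ BA.
have card_s (X : {set 'I_m}) : #|s @: X| = #|X| by rewrite card_imset //; apply: perm_inj.
have sK (X : {set 'I_m}) : s @: (s @^-1: X) = X by apply/esym/eqP; rewrite -preimset_perm_eq.
apply/setP=> U; apply/idP/imsetP => [/fP[Uk Umax]|[W /fP[Wk Wmax] ->]].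
  exists (s @^-1: U); last by rewrite sK.
  apply/fP; split=> [|W' W'k]; first by rewrite -card_s sK.
  by rewrite -!scoreE sK; apply: Umax; rewrite card_s.
apply/fP; split=> [|W' W'k]; first by rewrite card_s.
by rewrite -[W']sK !scoreE; apply: Wmax; rewrite -card_s sK.
Qed.

Lemma bswav_consistent : consistent f.
Proof.
move=> A A' B dA sB /set0Pn[W0]; rewrite inE => /andP[/fP[W0k W0A] /fP[_ W0A']].
have scoreE W := bswav_score_sum alpha W dA sB.
apply/setP=> W; rewrite inE; apply/idP/andP=> [/fP[Wk Wmax]|[/fP[Wk WA] /fP[_ WA']]].
  have := Wmax _ W0k; rewrite !scoreE => W0W.
  have := W0A _ Wk; have := W0A' _ Wk => lt1 lt2.
  split; apply/fP; split=> // W' W'k.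
    by have := W0A _ W'k; lra.
  by have := W0A' _ W'k; lra.
by apply/fP; split=> // W' W'k; rewrite !scoreE lerD ?WA ?WA'.
Qed.

Lemma bswav_continuous : continuous f.
Proof.
move=> A A'; have [/set0Pn[W0 /fP[W0k W0A]] _] := f_rule A.
pose s := bswav_score alpha A; pose s' := bswav_score alpha A'.
(* With [bnd W] copies of [A], the lead of [W0] over [W] exceeds what [W] gains from [A']; the
   maximum serves all committees at once. A tie divides by zero and gives 0, but the bound is
   applied only when the gap is positive. *)
pose bnd W := Num.bound `|(s' W - s' W0) / (s W0 - s W)|.
exists (\max_W bnd W).+1 => // C B cC dC sB; apply/subsetP=> W /fP[Wk Wmax].
apply/fP; split=> // W' W'k; apply: le_trans (W0A _ W'k) _.
rewrite leNgt; apply/negP => ltW.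
have := Wmax _ W0k; rewrite !(bswav_score_sum _ _ dC sB) !(bswav_score_copies _ _ cC).
apply/negP; rewrite -ltNge -/(s W) -/(s W0) -/(s' W) -/(s' W0).
have gap : 0 < s W0 - s W by rewrite subr_gt0.
have : `|(s' W - s' W0) / (s W0 - s W)| < (bnd W)%:R by apply: archi_boundP.
move/(le_lt_trans (ler_norm _)); rewrite ltr_pdivrMr // => lt_bnd.
have : (bnd W)%:R * (s W0 - s W) <= (\max_W bnd W).+1%:R * (s W0 - s W).
  by rewrite ler_pM2r // ler_nat ltnW // ltnS leq_bigmax.
have arith (n b x x0 y y0 : R) : y - y0 < b * (x0 - x) ->
    b * (x0 - x) <= n * (x0 - x) -> x * n + y < x0 * n + y0 by move=> *; lra.
by rewrite -[s W *+ _]mulr_natr -[s W0 *+ _]mulr_natr; apply: arith.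
Qed.

(* [W''] and its mirror image in the interval spanned by [W] and [W'] have
   together the same members, with multiplicity, as [W] and [W']. *)
Lemma bswav_convex : choice_set_convex k f.
Proof.
move=> A W W' W'' /fP[Wk Wmax] /fP[W'k W'max] W''k sub1 sub2.
pose V := (W :&: W') :|: ((W :|: W') :\: W'').
have sumE (T : nmodType) (g : 'I_m -> T) :
    \sum_(c in W'') g c + \sum_(c in V) g c = \sum_(c in W) g c + \sum_(c in W') g c.
  have mkcond (X : {set 'I_m}) :
    \sum_(c in X) g c = \sum_c (if c \in X then g c else 0) by apply: big_mkcond.
  rewrite !mkcond -!big_split /=.
  apply: eq_bigr => c _; rewrite !inE.
  have := subsetP sub1 c; have := subsetP sub2 c; rewrite !inE.
  by case: (c \in W''); case: (c \in W); case: (c \in W') => //=;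
     rewrite ?addr0 ?add0r // => H1 H2; [move: (H1 isT)|move: (H2 isT)].
(* The same identity with constant weight 1 yields the cardinality. *)
have Vk : #|V| = k.
  by have := sumE nat (fun=> 1%N); rewrite !sum1_card; lia.
apply/fP; split=> // U Uk; have := Wmax V Vk; have := W'max U Uk.
have := sumE _ (candidate_score alpha (ballot_count A)); rewrite -!bswav_scoreE.
lra.
Qed.

Lemma bswav_weakly_efficient : weakly_efficient f.
Proof.
move=> A W c /fP[Wk Wmax] cW cA c' c'W.
have -> : (W :|: [set c']) :\ c = c' |: W :\ c.
  by rewrite setUC setDUl; congr (_ :|: _); apply/setDidPl; rewrite disjoints1 inE;
     apply: contraNneq c'W => ->.
apply/fP; split=> [|U Uk]; first by rewrite card_exchange.
apply: le_trans (Wmax _ Uk) _; rewrite bswav_score_exchange // lerDl.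
have -> : candidate_score alpha (ballot_count A) c = 0.
  rewrite /candidate_score big1 // => S cS.
  rewrite ffunE (eq_count (a2 := pred0)) ?count_pred0 ?mulr0 // => i /=.
  by apply/eqP => /cA; rewrite cS.
rewrite subr0 sumr_ge0 // => S c'S; rewrite mulr_ge0 //.
  have Sm : (#|S| <= m)%N by rewrite -[m in (_ <= m)%N]card_ord max_card.
  apply: alpha_ge0; rewrite Sm andbT card_gt0.
  by apply/set0Pn; exists c'.
by rewrite ffunE ler0z.
Qed.

End BSWAVAxioms.

Lemma is_BSWAVP (R : realType) m (k : nat) (f : profile m -> {set {set 'I_m}})
    (alpha : nat -> R) :
  (forall A : profile m,
      f A = [set W : {set 'I_m} | (#|W| == k) &&
              [forall W' : {set 'I_m}, (#|W'| == k) ==>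
                 (bswav_score alpha A W' <= bswav_score alpha A W)%R]]) <->
  (forall A W, W \in f A <-> bswav_winner k alpha A W).
Proof.
have maxP A W : reflect (bswav_winner k alpha A W)
    ((#|W| == k) && [forall W' : {set 'I_m}, (#|W'| == k) ==>
                 (bswav_score alpha A W' <= bswav_score alpha A W)%R]).
  apply: (iffP andP) => [[/eqP Wk /forallP Wmax]|[Wk Wmax]]; split=> //.
  - by move=> W' /eqP W'k; have /implyP := Wmax W'; apply.
  - exact/eqP.
  - by apply/forallP=> W'; apply/implyP => /eqP/Wmax.
split=> fE A; last by apply/setP=> W; rewrite inE; apply/idP/maxP => /fE.
by move=> W; rewrite fE inE; split=> /maxP.
Qed.

(** * Signs of the weights *)

(** On a single ballot [S] of size [j] with negative weight, a winner would contain some [c] outside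
    [S] and omit some [c'] of [S]. Weak efficiency would let [c'] replace [c], although this lowers
    the score. The bound [j < m] provides a candidate outside [S]. *)
Lemma weight_ge0 (R : realType) m (k : nat) (f : profile m -> {set {set 'I_m}})
    (alpha : nat -> R) :
  (0 < k < m)%N -> is_ABC_rule k f -> weakly_efficient f ->
  (forall A W, W \in f A <-> bswav_winner k alpha A W) ->
  forall j, (0 < j < m)%N -> 0 <= alpha j.
Proof.
move=> kb f_rule f_weff fP j jb.
have [|S _ Sj] := @ex_subset_card _ [set: 'I_m] j; first by rewrite cardsT card_ord; lia.
have [|A [AE A_only]] := @single_profile m S; first by rewrite -card_gt0 Sj; lia.
have swap W a b : W \in f A -> a \in W -> b \notin W ->
    (if b \in S then alpha j else 0) <= (if a \in S then alpha j else 0).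
  case/fP=> Wk Wmax aW bW; have := Wmax (b |: W :\ a).
  rewrite card_exchange // => /(_ Wk); rewrite bswav_score_exchange // AE.
  by rewrite !candidate_score_unit Sj gerDl subr_le0.
have [/set0Pn[W Wf] f_card] := f_rule A; have Wk := f_card _ Wf.
rewrite leNgt; apply/negP => alpha0.
have ltj a b : a \in W -> b \notin W -> a \in S -> b \in S.
  move=> aW bW aS; have := swap W a b Wf aW bW; rewrite aS; case: ifP => //.
  by rewrite leNgt alpha0.
have outside (X : {set 'I_m}) : (#|X| < m)%N -> exists c, c \notin X.
  move=> Xm; have /set0Pn[c] : ~: X != set0 by rewrite -card_gt0 cardsCs setCK card_ord subn_gt0.
  by rewrite inE; exists c.
have [c cW cS] : exists2 c, c \in W & c \notin S.
  have [d dS] := outside S ltac:(by rewrite Sj; lia).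
  have [dW|dW] := boolP (d \in W); first by exists d.
  have /set0Pn[x xW] : W != set0 by rewrite -card_gt0 Wk; lia.
  by exists x => //; apply: contra dS; apply: ltj.
have [c' c'S c'W] : exists2 c', c' \in S & c' \notin W.
  have /set0Pn[x xS] : S != set0 by rewrite -card_gt0 Sj; lia.
  have [xW|xW] := boolP (x \in W); last by exists x.
  have [d dW] := outside W ltac:(by rewrite Wk; lia).
  by exists d => //; apply: ltj xS.
have W2f : (W :|: [set c']) :\ c \in f A.
  by apply: f_weff => // i X /A_only ->.
suff : 0 <= alpha j by rewrite leNgt alpha0.
have := swap _ c' c W2f; rewrite (negPf cS) c'S; apply.
  by rewrite !inE eqxx orbT andbT; apply: contraNneq c'W => ->.
by rewrite !inE eqxx.
Qed.

Local Close Scope ring_scope.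

Theorem theorem2 (R : realType) (m k : nat) (f : profile m -> {set {set 'I_m}}) :
  2 <= m -> 0 < k < m -> is_ABC_rule k f ->
  (is_BSWAV k f R <->
   anonymous f /\ neutral f /\ consistent f /\ continuous f /\
   choice_set_convex k f /\ weakly_efficient f).
Proof.
move=> _ kb f_rule; split=> [[alpha [alpha_ge0 /is_BSWAVP fP]]|].
  split; first exact: bswav_anonymous fP.
  split; first exact: bswav_neutral fP.
  split; first exact: bswav_consistent fP.
  split; first exact: bswav_continuous f_rule fP.
  split; first exact: bswav_convex fP.
  exact: bswav_weakly_efficient alpha_ge0 fP.
move=> [f_anon [f_neut [f_cons [f_cont [f_conv f_weff]]]]].
have [alpha [alpha_m alphaP]] :=
  axioms_representation kb f_rule f_anon f_neut f_cons f_cont f_conv R.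
have fP A W : W \in f A <-> bswav_winner k alpha A W.
  split=> [WA|[Wk Wmax]]; last exact/alphaP.
  have Wk : #|W| = k by have [_] := f_rule A; apply.
  by split=> //; apply/alphaP.
exists alpha; split=> [j /andP[j0 jm]|]; last exact/is_BSWAVP.
have [jm'|] := ltnP j m; first by apply: (weight_ge0 kb f_rule f_weff fP); rewrite j0.
by move=> mj; rewrite (_ : j = m) ?alpha_m //; apply/eqP; rewrite eqn_leq jm.
Qed.
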